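(* Let $G=(V,E)$ be a finite simple graph with squared analytic torsion $A(G)=\prod_{k}\mathrm{Det}(L_k)^{k(-1)^{k+1}}$. Then: (1) If $G$ is homotopic to $1$, then $A(G)=|V|$. (2) If $G$ is triangle-free, then $A(G)$ is the number of rooted spanning trees in $G$. (3) If $G$ is a $(2r+1)$-sphere, then $A(G)=|V|\,|V'|$. (4) If $G$ is a $(2r)$-sphere, then $A(G)=|V|/|V'|$. (5) If $G$ is a $2$-sphere, then $A(G)$ is the ratio of the number of spanning trees in $G$ and the number of spanning trees in the dual graph $G'$.
   Context: Let $G=(V,E)$ be a finite simple graph. A $k$-simplex of $G$ is (the vertex set of) a complete subgraph $K_{k+1}$; the set of all simplices is the Whitney (clique) complex of $G$, $f_k$ is the number of $k$-simplices, and $m$ is the maximal dimension of a simplex. Order the vertices; for a $(k+1)$-simplex $x=\{v_0<\dots<v_{k+1}\}$ and $y=x\setminus\{v_i\}$ put $\mathrm{sign}(y,x)=(-1)^i$. The exterior derivative $d_k$ is the $f_{k+1}\times f_k$ matrix given by $d_kf(x)=\sum_{y\subset x,\ \dim y=k}\mathrm{sign}(y,x)f(y)$ (with $d_{-1}=0$, $d_m=0$). The $k$-form Laplacian is $L_k=d_k^*d_k+d_{k-1}d_{k-1}^*$ for $0\le k\le m$. The pseudo determinant $\mathrm{Det}(M)$ of a square matrix $M$ is the product of its non-zero eigenvalues, counted with multiplicity (equal to $1$ if there are none). The unit sphere $S(v)$ of a vertex $v$ is the subgraph induced by the neighbors of $v$; $G-v$ is the subgraph induced by $V\setminus\{v\}$.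 Contractible graphs are defined inductively: the one-point graph $1=K_1$ is contractible, and $G$ is contractible if there is a vertex $v$ such that both $S(v)$ and $G-v$ are contractible. $G$ is homotopic to $1$ if it can be transformed into $K_1$ by finitely many steps, each being either the removal $G\to G-x$ of a vertex $x$ with contractible $S(x)$, or the inverse step of adding a new vertex $x$ joined exactly to the vertices of a contractible subgraph $H$. Spheres are defined inductively: the empty graph is the $(-1)$-sphere, and for $k\ge0$ a $k$-sphere is a graph all of whose unit spheres $S(v)$ are $(k-1)$-spheres and such that $G-v$ is contractible for some vertex $v$. The dual graph $G'$ has as vertex set $V'$ the set of facets (maximal simplices) of $G$; two facets $x,y$ are adjacent if $x\cap y$ has co-dimension $1$. A rooted spanning tree is a spanning tree together with a choice of one vertex (the root).
   Formalization: In (2) G is also assumed connected: a disconnected graph has no spanning tree while A(G) is non-zero. In (5) spanning trees are counted as rooted: with unrooted trees the ratio is 1, contradicting (4), e.g. for the octahedron, where A(G) = 6/8. *)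

(* Defs.v *)
From HB Require Import structures.
From mathcomp Require Import all_boot all_order all_algebra.

Set Implicit Arguments.
Unset Strict Implicit.
Unset Printing Implicit Defensive.

Import Order.TTheory GRing.Theory Num.Theory.
Local Open Scope ring_scope.

Record sgraph := SGraph {
  vertex :> finType;
  adj : rel vertex;
  adj_sym : symmetric adj;
  adj_irr : irreflexive adj
}.

Section Subgraphs.
Variable G : sgraph.

Definition induced_adj (A : {set G}) : rel {x : G | x \in A} :=
  fun u v => adj (val u) (val v).

Lemma induced_sym A : symmetric (@induced_adj A).
Proof. by move=> u v; apply: adj_sym. Qed.

Lemma induced_irr A : irreflexive (@induced_adj A).
Proof. by move=> u; apply: adj_irr. Qed.

Definition induced (A : {set G}) : sgraph :=
  SGraph (@induced_sym A) (@induced_irr A).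

Definition unit_sphere (v : G) : sgraph := induced [set w | adj v w].

Definition remove_vertex (v : G) : sgraph := induced [set~ v].

Definition extend_adj (A : {set G}) : rel (option G) := fun u v =>
  match u, v with
  | Some u', Some v' => adj u' v'
  | Some w, None | None, Some w => w \in A
  | None, None => false
  end.

Lemma extend_sym A : symmetric (extend_adj A).
Proof. by case=> [u|] [v|] //=; apply: adj_sym. Qed.

Lemma extend_irr A : irreflexive (extend_adj A).
Proof. by case=> [u|] //=; apply: adj_irr. Qed.

(* [None] is the new vertex; its unit sphere is a copy of [induced A]. *)
Definition add_vertex (A : {set G}) : sgraph :=
  SGraph (extend_sym A) (extend_irr A).

(* (V, F); the conjunct [u != v] only discards singletons that a general F
   might contain, it is redundant when F is a set of edges. *)
Definition span_adj (F : {set {set G}}) : rel G :=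
  fun u v => (u != v) && ([set u; v] \in F).

Lemma span_sym F : symmetric (span_adj F).
Proof. by move=> u v; rewrite /span_adj eq_sym setUC. Qed.

Lemma span_irr F : irreflexive (span_adj F).
Proof. by move=> u; rewrite /span_adj eqxx. Qed.

Definition spanning_subgraph (F : {set {set G}}) : sgraph :=
  SGraph (span_sym F) (span_irr F).

End Subgraphs.

Inductive contractible : sgraph -> Prop :=
| contractible_one (G : sgraph) : #|G| = 1%N -> contractible G
| contractible_step (G : sgraph) (v : G) :
    contractible (unit_sphere v) -> contractible (remove_vertex v) ->
    contractible G.

Inductive homotopic_to_one : sgraph -> Prop :=
| homotopic_one (G : sgraph) : #|G| = 1%N -> homotopic_to_one G
| homotopic_remove (G : sgraph) (v : G) :
    contractible (unit_sphere v) -> homotopic_to_one (remove_vertex v) ->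
    homotopic_to_one G
| homotopic_add (G : sgraph) (A : {set G}) :
    contractible (induced A) -> homotopic_to_one (add_vertex A) ->
    homotopic_to_one G.

(* [sphere_succ n G] says that G is an (n-1)-sphere, so that the recursion can
   start at the (-1)-sphere. *)
Fixpoint sphere_succ (n : nat) (G : sgraph) : Prop :=
  match n with
  | 0 => #|G| = 0%N
  | n'.+1 => (forall v : G, sphere_succ n' (unit_sphere v)) /\
             (exists v : G, contractible (remove_vertex v))
  end.

Definition sphere (k : nat) (G : sgraph) : Prop := sphere_succ k.+1 G.

Definition triangle_free (G : sgraph) : Prop :=
  forall u v w : G, ~~ [&& adj u v, adj v w & adj u w].

Definition connected (G : sgraph) : bool :=
  (0 < #|G|)%N && [forall u : G, forall v : G, connect (@adj G) u v].

(* A simple cycle has at most #|G| vertices, so it is enough to look at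
   tuples of at most that size; see [acyclicP]. *)
Definition acyclic (G : sgraph) : bool :=
  ~~ [exists n : 'I_#|G|.+1, exists s : n.-tuple G,
        (2 < n)%N && ucycleb (@adj G) s].

Lemma acyclicP (G : sgraph) :
  reflect (forall s : seq G, ucycle (@adj G) s -> (size s <= 2)%N) (acyclic G).
Proof.
apply: (iffP idP) => [acG s cs | acG].
  rewrite leqNgt; apply: contra acG => lt2s.
  have us : uniq s by case/andP: cs.
  have les : (size s < #|G|.+1)%N by rewrite ltnS -(card_uniqP us) max_card.
  apply/existsP; exists (Ordinal les); apply/existsP; exists (in_tuple s).
  by rewrite /= lt2s.
apply/existsPn => n; apply/existsPn => s; apply/negP => /andP[lt2n cs].
by have := acG s cs; rewrite size_tuple leqNgt lt2n.
Qed.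

Definition tree (G : sgraph) : bool := connected G && acyclic G.

Section Complex.
Variable G : sgraph.

(* The empty set is not a simplex. *)
Definition simplex (x : {set G}) : bool :=
  (x != set0) &&
  [forall u in x, forall v in x, (u != v) ==> adj u v].

Definition simplices (k : nat) : {set {set G}} :=
  [set x | simplex x & #|x| == k.+1].

(* One more than the maximal dimension of a simplex (0 for the empty graph). *)
Definition clique_number : nat := (\max_(x : {set G} | simplex x) #|x|)%N.

Definition facets : {set {set G}} := [set x | maxset simplex x].

Definition spanning_tree (F : {set {set G}}) : bool :=
  (F \subset simplices 1) && tree (spanning_subgraph F).

Definition rooted_spanning_trees : {set {set {set G}} * G} :=
  [set p | spanning_tree p.1].

End Complex.

Section Dual.
Variable G : sgraph.

Definition dual_adj : rel {x : {set G} | x \in facets G} := fun x y =>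
  (#|val x| == #|val x :&: val y|.+1) && (#|val y| == #|val x :&: val y|.+1).

Lemma dual_sym : symmetric dual_adj.
Proof. by move=> x y; rewrite /dual_adj setIC andbC. Qed.

Lemma dual_irr : irreflexive dual_adj.
Proof. by move=> x; rewrite /dual_adj setIid andbb; elim: #|_|. Qed.

Definition dual : sgraph := SGraph dual_sym dual_irr.

End Dual.

Section PseudoDeterminant.
Variable C : numClosedFieldType.

(* Eigenvalues with algebraic multiplicity. *)
Definition eigenvalues n (M : 'M[C]_n) : seq C :=
  sval (closed_field_poly_normal (char_poly M)).

Lemma eigenvaluesP n (M : 'M[C]_n) :
  char_poly M = \prod_(a <- eigenvalues M) ('X - a%:P).
Proof.
rewrite /eigenvalues; case: closed_field_poly_normal => r /= {1}->.
by rewrite (monicP (char_poly_monic M)) scale1r.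
Qed.

Definition Det n (M : 'M[C]_n) : C := \prod_(a <- eigenvalues M | a != 0) a.

End PseudoDeterminant.

Section Hodge.
Variables (C : numClosedFieldType) (G : sgraph) (le : rel G).

(* The index i of v = v_i in x = {v_0 < ... < v_k}, for [le] a total order. *)
Definition position (x : {set G}) (v : G) : nat :=
  #|[set w in x | (w != v) && le w v]|.

(* (-1)^i if y = x \ {v_i} (a condition met by at most one v in x), and 0 if
   y is not of that form. *)
Definition incidence (y x : {set G}) : C :=
  \sum_(v in x | y == x :\ v) (-1) ^+ position x v.

Definition exterior_derivative (k : nat) :
    'M[C]_(#|simplices G k.+1|, #|simplices G k|) :=
  \matrix_(i, j) incidence (enum_val j) (enum_val i).

(* The entries of d_k are real, so that its adjoint is its transpose. *)
Definition laplacian (k : nat) : 'M[C]_#|simplices G k| :=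
  (exterior_derivative k)^T *m exterior_derivative k +
  match k with
  | 0 => 0
  | k'.+1 => exterior_derivative k' *m (exterior_derivative k')^T
  end.

Definition torsion : C :=
  \prod_(k < clique_number G) Det (laplacian k) ^ (k%:Z * (-1) ^+ k.+1).

End Hodge.

(* Main.v *)
Require Import Defs.
From HB Require Import structures.
From mathcomp Require Import all_boot all_order all_algebra all_fingroup.
From mathcomp Require Import zify ring.

Set Implicit Arguments.
Unset Strict Implicit.
Unset Printing Implicit Defensive.

Import Order.TTheory GRing.Theory Num.Theory.
Local Open Scope ring_scope.

(** Since d d = 0, Det L_k = Det(d_k^* d_k) Det(d_(k-1)^* d_(k-1)), so that
    A(G) is the alternating product of the Det(d_k^* d_k).

    Suppose that the reduced simplicial chain complex is exact over the integers
    (for a sphere: exact once the inclusion of the fundamental cycle is added at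
    the top). The Smith normal form then factors each boundary map as A B, where
    A has an integral left inverse and B an integral right inverse. For such a
    factorization Det((A B)(A B)^T) = det(A^T A) det(B B^T), and exactness at the
    next spot, where A' takes the place of A, gives det(B B^T) = det(A'^T A'):
    both are det(B^T | A') up to the same unit. The alternating product
    telescopes, and only the two ends remain: |V| from the augmentation and,
    for a sphere, the squared norm |V'| of a fundamental cycle with
    coefficients +-1.

    Exactness for graphs homotopic to 1 comes from attaching or removing a cone
    over an acyclic complex. Over a sphere S(v) with G - v acyclic the same
    argument yields the fundamental cycle, and its coefficients are +-1 because
    their absolute value is constant on the star of each vertex.

    The statements on spanning trees follow from the matrix-tree theorem. For a
    2-sphere the signs of the fundamental cycle conjugate the top Laplacian into
    the Laplacian of the dual graph. *)

(** * Pseudo determinants and the Cauchy-Binet formula *)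

(** Integrality carries the argument. Over a field, exactness would relate det(B B^T) and det(A'^T
    A') only up to the square of a change-of-basis determinant; over the integers that determinant
    is a unit and its square is 1.

    Contractible graphs and spheres are defined by inductions that replace the graph at every step.
    To keep signs and chains comparable, all subgraphs are viewed inside one ordered ambient graph:
    a chain is a function on all vertex sets, and a subgraph is a condition on its support. For
    spheres a single induction carries purity, thinness (each ridge lies in two facets) and the
    fundamental cycle. Purity is what spreads the coefficients +-1 from star to star, and thinness
    is what turns the top Laplacian into that of the dual graph.

    The count of spanning trees of a triangle-free graph is stated for connected graphs: a
    disconnected graph has no spanning tree, whereas a pseudo determinant never vanishes. *)

Lemma det_sub_mulmxC (R : comNzRingType) m n (x : R)
    (A : 'M[R]_(m, n)) (B : 'M[R]_(n, m)) :
  x ^+ n * \det (x%:M - A *m B) = x ^+ m * \det (x%:M - B *m A).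
Proof.
(* Eliminating [B] from the right leaves [x - A B], eliminating it from the left leaves [x - B A];
   the left multiplier has determinant [x ^+ n]. *)
pose M := block_mx x%:M A B (1%:M : 'M_n).
have e1 : \det M = \det (x%:M - A *m B).
  have -> : \det M = \det (M *m block_mx 1%:M 0 (- B) 1%:M).
    by rewrite det_mulmx det_lblock !det1 !mulr1.
  rewrite mulmx_block !mulmx1 !mulmx0 !mul1mx !add0r subrr mulmxN.
  by rewrite det_ublock det1 mulr1.
have e2 : x ^+ n * \det M = x ^+ m * \det (x%:M - B *m A).
  have -> : x ^+ n * \det M = \det (block_mx 1%:M 0 (- B) x%:M *m M).
    by rewrite det_mulmx det_lblock det1 mul1r det_scalar.
  rewrite mulmx_block !mul1mx !mulmx1 !mul0mx !addr0 mulNmx.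
  by rewrite scalar_mxC addNr det_ublock det_scalar mulNmx addrC.
by rewrite -e1.
Qed.

Lemma det_add1_mulmxC (R : comNzRingType) m n
    (A : 'M[R]_(m, n)) (B : 'M[R]_(n, m)) :
  \det (1%:M + A *m B) = \det (1%:M + B *m A).
Proof.
have := det_sub_mulmxC 1 A (- B).
by rewrite !expr1n !mul1r mulmxN mulNmx !opprK.
Qed.

Section PseudoDeterminantTheory.
Variable C : numClosedFieldType.

(** [Det] does not see zero roots, so a factor ['X^a] may be added to compare matrices of different
    sizes. *)
Lemma Det_root_seq n (M : 'M[C]_n) (a : nat) (s : seq C) :
  'X^a * char_poly M = \prod_(x <- s) ('X - x%:P) ->
  Det M = \prod_(x <- s | x != 0) x.
Proof.
rewrite eigenvaluesP => eqM.
have /prod_XsubC_eq eqs :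
    \prod_(x <- nseq a 0 ++ eigenvalues M) ('X - x%:P) =
    \prod_(x <- s) ('X - x%:P) :> {poly C}.
  rewrite -eqM big_cat /= big_nseq; congr (_ * _).
  by elim: a {eqM} => [|a IHa] /=; rewrite ?expr0 // IHa subr0 exprS.
rewrite -(perm_big _ eqs) big_cat /= [X in X * _]big1_seq ?mul1r //.
by move=> x /andP[x0]; move/nseqP=> [xe _]; rewrite xe eqxx in x0.
Qed.

Lemma Det_neq0 n (M : 'M[C]_n) : Det M != 0.
Proof. by rewrite prodf_seq_neq0; apply/allP => x _; apply/implyP. Qed.

Lemma Det_mulmxC m n (A : 'M[C]_(m, n)) (B : 'M[C]_(n, m)) :
  Det (A *m B) = Det (B *m A).
Proof.
pose s := nseq m 0 ++ eigenvalues (B *m A).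
have sE : 'X^m * char_poly (B *m A) = \prod_(x <- s) ('X - x%:P).
  rewrite big_cat /= big_nseq eigenvaluesP; congr (_ * _).
  by elim: m {A B s} => [|a IHa] /=; rewrite ?expr0 // -IHa subr0 exprS.
rewrite (Det_root_seq sE); apply: (@Det_root_seq _ _ n).
by rewrite -sE /char_poly /char_poly_mx !map_mxM det_sub_mulmxC.
Qed.

(** From A B = 0 follows (X - A)(X - B) = X (X - (A + B)), so the characteristic polynomials
    multiply up to a power of X. *)
Lemma Det_addM n (A B : 'M[C]_n) :
  A *m B = 0 -> Det (A + B) = Det A * Det B.
Proof.
move=> AB0.
rewrite (@Det_root_seq _ _ n (eigenvalues A ++ eigenvalues B)).
  by rewrite big_cat.
rewrite big_cat /= -!eigenvaluesP /char_poly -det_mulmx -det_scalar -det_mulmx.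
congr (\det _); rewrite /char_poly_mx mulmxBl !mulmxBr -map_mxM AB0 map_mx0.
rewrite subr0 map_mxD mulmxDr opprD addrA.
by rewrite [map_mx _ A *m _]scalar_mxC addrAC.
Qed.

Lemma Det_unit n (A : 'M[C]_n) : \det A != 0 -> Det A = \det A.
Proof.
move=> A0; have sA : size (eigenvalues A) = n.
  by have := size_char_poly A; rewrite eigenvaluesP size_prod_XsubC => -[].
have dE : \det A = \prod_(x <- eigenvalues A) x.
  have := char_poly_det A; rewrite eigenvaluesP coef0_prod_XsubC sA.
  have n1 : (-1 : C) ^+ n != 0 by rewrite expf_neq0 // oppr_eq0 oner_eq0.
  by move/(mulfI n1) => <-.
rewrite dE /Det big_seq_cond [RHS]big_seq_cond; apply: eq_bigl => x.
rewrite andbT; case xA: (x \in _) => //=; apply: contraNN A0 => /eqP x0.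
by rewrite dE prodf_seq_eq0; apply/hasP; exists x => //=; apply/eqP.
Qed.

Lemma Det_conj n (P M : 'M[C]_n) : P *m P = 1%:M -> Det (P *m M *m P) = Det M.
Proof. by move=> PP; rewrite Det_mulmxC mulmxA PP mul1mx. Qed.

Lemma Det_gram m n (M : 'M[C]_(m, n)) : Det (M^T *m M) = Det (M *m M^T).
Proof. exact: Det_mulmxC. Qed.

(** Cyclic invariance moves everything to the r x r matrix B B^T A^T A, which is invertible, so that
    its pseudo determinant is its determinant. *)
Lemma Det_fullrank_mulmx p r q (A : 'M[C]_(p, r)) (B : 'M[C]_(r, q)) :
  \det (A^T *m A) != 0 -> \det (B *m B^T) != 0 ->
  Det (A *m B *m (A *m B)^T) = \det (A^T *m A) * \det (B *m B^T).
Proof.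
move=> a0 b0; rewrite trmx_mul -mulmxA Det_mulmxC [B *m (_ *m _)]mulmxA -mulmxA.
by rewrite Det_unit det_mulmx ?mulf_neq0 // mulrC.
Qed.

End PseudoDeterminantTheory.

(* The Cauchy-Binet formula, indexed by all functions into the summation range
   rather than by subsets; each subset is then counted [n`!] times. *)
Lemma det_mulmx_ffun (R : comNzRingType) (I : finType) n (A B : 'I_n -> I -> R) :
  \det (\matrix_(i, j) \sum_(k : I) A i k * B j k) *+ n`! =
  \sum_(f : {ffun 'I_n -> I})
     \det (\matrix_(i, j) A i (f j)) * \det (\matrix_(i, j) B i (f j)).
Proof.
set M := \matrix_(i, j) _.
(* The same determinant is expanded once for every permutation [t], after substituting f o t^-1 for
   f. Summing these n! expansions assembles the determinant of [A]. *)
have expand (t : 'S_n) : \det M = \sum_(f : {ffun 'I_n -> I})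
    ((-1) ^+ t * \prod_i A (t i) (f i)) * \det (\matrix_(i, j) B i (f j)).
  transitivity (\sum_(f : {ffun 'I_n -> I}) \sum_(s : 'S_n)
      (-1) ^+ s * \prod_i (A i (f i) * B (s i) (f i))).
    rewrite exchange_big; apply: eq_bigr => /= s _; rewrite -big_distrr /=.
    congr (_ * _).
    rewrite -(bigA_distr_bigA (fun i k => A i k * B (s i) k)) /=.
    by apply: eq_bigr => i _; rewrite mxE.
  have tK : {on [pred _ : {ffun 'I_n -> I} | true], bijective
      (fun f : {ffun 'I_n -> I} => [ffun i => f ((t^-1)%g i)])}.
    exists (fun f : {ffun 'I_n -> I} => [ffun i => f (t i)]) => f _;
      by apply/ffunP => i; rewrite !ffunE ?permK ?permKV.
  rewrite (reindex _ tK) /=; apply: eq_bigr => f _.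
  rewrite -[\det (\matrix_(i, j) B _ _)]det_tr [\det _]/determinant.
  rewrite (reindex_inj (mulgI (t^-1)%g)) /= big_distrr /=; apply: eq_bigr => s _.
  rewrite odd_permM odd_permV signr_addb -!mulrA; congr (_ * _).
  rewrite mulrCA; congr (_ * _).
  rewrite (reindex_perm t) big_split /=; congr (_ * _); apply: eq_bigr => i _.
    by rewrite ffunE permK.
  by rewrite !mxE ffunE !permM permK.
rewrite -card_Sn -sumr_const.
under eq_bigr => t _ do rewrite (expand t).
rewrite exchange_big; apply: eq_bigr => f _; rewrite -mulr_suml; congr (_ * _).
rewrite -[RHS]det_tr; apply: eq_bigr => t _; congr (_ * _).
by apply: eq_bigr => i _; rewrite !mxE.
Qed.

(** * Unimodular factorizations of integer matrices *)

(** By Cauchy-Binet the Gram determinant is a sum of squares of maximal minors of [A]. If it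
    vanished, so would all these minors, and with them det(S A) = 1. *)
Lemma gram_neq0 m r (A : 'M[int]_(m, r)) (S : 'M[int]_(r, m)) :
  S *m A = 1%:M -> \det (A^T *m A) != 0.
Proof.
move=> SA; apply/eqP => A0.
pose a (i : 'I_r) (k : 'I_m) := A k i.
have := det_mulmx_ffun a a.
have -> : (\matrix_(i, j) \sum_k a i k * a j k) = A^T *m A.
  by apply/matrixP => i j; rewrite !mxE; apply: eq_bigr => k _; rewrite !mxE.
rewrite A0 mul0rn => /esym/eqP; rewrite psumr_eq0; last first.
  by move=> f _; rewrite -expr2 sqr_ge0.
move/allP => a0; have := det_mulmx_ffun (fun i k => S i k) a.
have -> : (\matrix_(i, j) \sum_k S i k * a j k) = 1%:M.
  by rewrite -SA; apply/matrixP => i j; rewrite !mxE.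
rewrite det1 big1 => [/eqP|f _]; first by rewrite pnatr_eq0 eqn0Ngt fact_gt0.
have := a0 f (mem_index_enum _); rewrite -expr2 sqrf_eq0 => /eqP ->.
by rewrite mulr0.
Qed.

(** The one-sided inverses are integral: the image of [M] is a direct summand, with the columns of
    [uf_l] as a basis. *)
Record unimod_fact m n (M : 'M[int]_(m, n)) := UnimodFact {
  uf_rank : nat;
  uf_l : 'M[int]_(m, uf_rank);
  uf_r : 'M[int]_(uf_rank, n);
  uf_linv : 'M[int]_(uf_rank, m);
  uf_rinv : 'M[int]_(n, uf_rank);
  uf_eq : M = uf_l *m uf_r;
  uf_lK : uf_linv *m uf_l = 1%:M;
  uf_rK : uf_r *m uf_rinv = 1%:M
}.

Section UnimodularFactorization.
Variables (m n : nat) (M : 'M[int]_(m, n)).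

Definition gram_l (F : unimod_fact M) : int := \det ((uf_l F)^T *m uf_l F).
Definition gram_r (F : unimod_fact M) : int := \det (uf_r F *m (uf_r F)^T).

Lemma gram_l_neq0 F : gram_l F != 0.
Proof. exact: gram_neq0 (uf_lK F). Qed.

Lemma gram_r_neq0 F : gram_r F != 0.
Proof.
rewrite /gram_r -{1}[uf_r F]trmxK; apply: (@gram_neq0 _ _ _ (uf_rinv F)^T).
by rewrite -trmx_mul uf_rK trmx1.
Qed.

Lemma Det_unimod_fact (C : numClosedFieldType) (F : unimod_fact M) :
  let MC := map_mx intr M : 'M[C]_(m, n) in
  Det (MC *m MC^T) = (gram_l F)%:~R * (gram_r F)%:~R.
Proof.
have ME : map_mx intr M = map_mx intr (uf_l F) *m map_mx intr (uf_r F) :> 'M[C]_(_, _).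
  by rewrite -map_mxM -uf_eq.
rewrite /= ME.
have l0 := gram_l_neq0 F; have r0 := gram_r_neq0 F.
have el : \det ((map_mx intr (uf_l F))^T *m map_mx intr (uf_l F)) =
    (gram_l F)%:~R :> C by rewrite map_trmx -map_mxM det_map_mx.
have er : \det (map_mx intr (uf_r F) *m (map_mx intr (uf_r F))^T) =
    (gram_r F)%:~R :> C by rewrite map_trmx -map_mxM det_map_mx.
by rewrite Det_fullrank_mulmx ?el ?er ?intr_eq0.
Qed.

(** The cokernel of [M] is torsion-free. *)
Definition saturated : Prop := forall (c : int) (v : 'cV_m) (w : 'cV_n),
  c != 0 -> c *: v = M *m w -> exists w', v = M *m w'.

(** In a Smith normal form L D R, the multiple d_i L e_i lies in the image; by saturation so does L
    e_i, which forces d_i to be a unit whenever it is not 0. Divisibility puts the zeros last, so D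
    is a diagonal of signs followed by zeros. *)
Lemma saturated_unimod_fact : saturated -> unimod_fact M.
Proof.
move=> satM; have [L uL [R uR [d sd ME]]] := int_Smith_normal_form M.
set D := \matrix_(i, j) _ in ME.
have dsq (i : 'I_m) (j : 'I_n) : i = j :> nat -> d`_i != 0 -> d`_i * d`_i = 1.
  move=> ij d0; pose v : 'cV_m := L *m delta_mx i 0.
  pose w : 'cV_n := invmx R *m delta_mx j 0.
  have DE : D *m (delta_mx j 0 : 'cV_n) = d`_i *: delta_mx i 0.
    apply/colP => k; rewrite !mxE (bigD1 j) //= !mxE !eqxx /= mulr1 big1 => [|l lj].
      rewrite addr0 -ij ?andbT -val_eqE /=.
      by case: eqP => [->|_]; rewrite ?mulr1 ?mulr0.
    by rewrite !mxE (negPf lj) mulr0.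
  have vw : d`_i *: v = M *m w.
    by rewrite ME /w -!mulmxA mulKVmx // DE scalemxAr.
  have [w' /(congr1 (mulmx (invmx L)))] := satM _ _ _ d0 vw.
  rewrite ME /v -!mulmxA !mulKmx // => /colP/(_ i).
  rewrite !mxE !eqxx /= (bigD1 j) //= big1 => [|k kj].
    rewrite !mxE ij eqxx addr0 /= mulr1n => d1.
    have : (d`_j %| 1)%Z by apply/dvdzP; eexists; rewrite mulrC; exact: d1.
    by rewrite dvdz1; case: (d`_j) => [[|[|]]|[|]].
  by rewrite !mxE ij eq_sym val_eqE (negPf kj) mulr0n mul0r.
pose k := find (pred1 0) d.
have dlt i : (i < k)%N -> d`_i != 0 by move/(before_find 0) => /= ->.
have dge i : (k <= i)%N -> d`_i = 0.
  move=> ki; have [|si] := leqP (size d) i; first exact: nth_default.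
  have sk := leq_ltn_trans ki si.
  have hz : has (pred1 0) d by rewrite has_find.
  have /eqP dk := nth_find 0 hz.
  have := sorted_leq_nth dvdz_trans dvdzz 0 sd.
  by move/(_ k i sk si ki); rewrite dk dvd0z => /eqP.
(* The list [d] may be longer than the diagonal of the matrix, hence the second minimum. *)
pose r := minn k (minn m n).
have rm : (r <= m)%N by rewrite /r !geq_min leqnn !orbT.
have rn : (r <= n)%N by rewrite /r !geq_min leqnn !orbT.
pose E : 'M[int]_(m, r) := \matrix_(i, j) (d`_i *+ (i == j :> nat)).
have DE : D = E *m (pid_mx r : 'M_(r, n)).
  apply/matrixP => i j; rewrite !mxE.
  have [ir|ri] := ltnP i r.
    rewrite (bigD1 (Ordinal ir)) //= !mxE /= eqxx ir andbT big1 ?addr0.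
      by case: eqP => _; rewrite ?mulr1 ?mulr0.
    move=> l; rewrite -val_eqE /= eq_sym => /negPf li.
    by rewrite !mxE li mul0r.
  rewrite big1 => [|l _].
    case: eqP => [ij|]; rewrite ?mulr1n ?mulr0n //; apply: dge.
    move: ri; rewrite /r !geq_min => /or3P[//||]; first by rewrite leqNgt ltn_ord.
    by rewrite ij leqNgt ltn_ord.
  rewrite !mxE; case: eqP => [il|]; rewrite ?mul0r //.
  by move: ri; rewrite il leqNgt ltn_ord.
have EK : E^T *m E = 1%:M.
  apply/matrixP => i j; rewrite !mxE (bigD1 (widen_ord rm i)) //= !mxE /= eqxx.
  rewrite big1 ?addr0 => [|l].
    case: (eqVneq i j) => [->|ij]; last first.
      by rewrite val_eqE (negPf ij) mulr0n mulr0.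
    rewrite eqxx mulr1n (@dsq (widen_ord rm j) (widen_ord rn j)) //=.
    by apply: dlt; apply: leq_trans (ltn_ord j) _; rewrite /r geq_minl.
  by rewrite -val_eqE /= !mxE => /negPf ->; rewrite mul0r.
pose P : 'M[int]_(r, n) := pid_mx r; pose P' : 'M[int]_(n, r) := pid_mx r.
have PK : P *m P' = 1%:M by rewrite /P pid_mx_id // pid_mx_1.
exists r (L *m E) (P *m R) (E^T *m invmx L) (invmx R *m P').
- by rewrite ME DE -!mulmxA.
- by rewrite -!mulmxA mulKmx.
- by rewrite -!mulmxA mulKVmx.
Qed.

End UnimodularFactorization.

(** The last hypothesis is a splitting: the columns of [A] span the kernel of [B]. Then (B^T | A) is
    square, and multiplying it by either of two mutually inverse unimodular determinants gives one
    side each. *)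
Lemma gram_split f s r (B : 'M[int]_(s, f)) (B' : 'M[int]_(f, s))
    (A : 'M[int]_(f, r)) (A' Y : 'M[int]_(r, f)) :
  B *m B' = 1%:M -> A' *m A = 1%:M -> B *m A = 0 ->
  B' *m B + A *m Y = 1%:M ->
  \det (B *m B^T) = \det (A^T *m A).
Proof.
move=> BK AK BA split1.
have PQ : col_mx B A' *m row_mx B' A = block_mx 1%:M 0 (A' *m B') 1%:M.
  by rewrite mul_col_row BK AK BA.
have f_eq : f = (s + r)%N.
  apply/anti_leq/andP; split.
    by apply: (@mulmx1_min _ _ _ (row_mx B' A) (col_mx B Y)); rewrite mul_row_col.
  apply: (@mulmx1_min _ _ _ (col_mx B A')
    (row_mx B' A *m block_mx 1%:M 0 (- (A' *m B')) 1%:M)).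
  rewrite mulmxA PQ mulmx_block !(mulmx1, mul1mx, mulmx0, mul0mx) addr0 !add0r.
  by rewrite addrN -scalar_mx_block.
move: BK AK BA PQ {split1 Y}; subst f => BK AK BA PQ.
pose P := row_mx B^T A.
have d1 : \det (col_mx B A') * \det (row_mx B' A) = 1.
  by rewrite -det_mulmx PQ det_lblock !det1 mulr1.
have d2 : \det P * \det (row_mx B' A) = \det (A^T *m A).
  rewrite -det_tr -det_mulmx tr_row_mx trmxK mul_col_row BK BA det_lblock.
  by rewrite det1 mul1r.
have d3 : \det P * \det (col_mx B A') = \det (B *m B^T).
  rewrite -[\det (col_mx _ _)]det_tr -[\det P]det_tr -det_mulmx.
  rewrite tr_row_mx trmxK tr_col_mx mul_col_row -!trmx_mul BA AK trmx0 trmx1.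
  by rewrite det_ublock det1 mulr1.
(* Two integers with product 1 are equal. *)
rewrite -d2 -d3; congr (_ * _); move: d1.
set x := \det _; set y := \det _ => xy.
have : x \is a GRing.unit by apply/unitrPr; exists y.
move: xy; rewrite unfold_in /= => xy /pred2P[] xE; rewrite xE in xy *.
  by rewrite -xy mul1r.
by apply/eqP; rewrite eqr_oppLR -xy mulN1r.
Qed.

Lemma gram_exact p f q (M : 'M[int]_(p, f)) (N : 'M[int]_(f, q))
    (F : unimod_fact M) (H : unimod_fact N) :
  M *m N = 0 -> (forall v : 'cV_f, M *m v = 0 -> exists w, v = N *m w) ->
  gram_r F = gram_l H.
Proof.
move=> MN ex.
have BA : uf_r F *m uf_l H = 0.
  have: uf_linv F *m (uf_l F *m uf_r F) *m (uf_l H *m uf_r H) *m uf_rinv H = 0.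
    by rewrite -!uf_eq -(mulmxA _ M) MN mulmx0 mul0mx.
  by rewrite !mulmxA uf_lK mul1mx -mulmxA uf_rK mulmx1.
have MK : M *m (uf_rinv F *m uf_r F) = M.
  have: uf_l F *m uf_r F *m (uf_rinv F *m uf_r F) = uf_l F *m uf_r F.
    by rewrite -mulmxA (mulmxA (uf_r F)) uf_rK mul1mx.
  by rewrite -uf_eq.
(* The matrix 1 - B' B projects onto the kernel of [M]; exactness lifts its columns through [N],
   which gives the splitting needed in [gram_split]. *)
have colP' (j : 'I_f) :
    exists w, col j (1%:M - uf_rinv F *m uf_r F) = N *m w.
  by apply: ex; rewrite colE mulmxA mulmxBr mulmx1 MK subrr mul0mx.
have [W WE] := fin_all_exists colP'.
pose X := \matrix_(i, j) W j i 0.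
have XE : 1%:M - uf_rinv F *m uf_r F = N *m X.
  apply/matrixP => i j; have /colP/(_ i) := WE j; rewrite mxE => ->.
  by rewrite !mxE; apply: eq_bigr => k _; rewrite mxE.
apply: (gram_split (uf_rK F) (uf_lK H) BA (Y := uf_r H *m X)) => //.
by rewrite mulmxA -uf_eq -XE addrC subrK.
Qed.

(** * Determinants of integrally exact complexes *)

Lemma alternating_telescope (F : fieldType) (l r : nat -> F) m :
  (forall j, r j != 0) -> (forall j, (j < m)%N -> r j = l j.+1) ->
  \prod_(k < m) (l k.+1 * r k.+1) ^ ((-1) ^+ k) = r 0%N * r m ^ ((-1) ^+ m.+1).
Proof.
move=> r0; elim: m => [|m IHm] lr.
  by rewrite big_ord0 expr1 exprN1 divff.
rewrite big_ord_recr /= IHm => [|j jm]; last by apply: lr; rewrite ltnW.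
rewrite -lr // expfzMl mulrA -[_ * _ * (r m ^ _)]mulrA -expfzDr //.
by rewrite exprS mulN1r addNr expr0z mulr1 !exprS !mulN1r opprK.
Qed.

(** The factor a_k occurs in b_k and in b_(k+1), with total exponent k (-1)^(k+1) + (k+1) (-1)^k =
    (-1)^k. *)
Lemma torsion_telescope (F : fieldType) (a b : nat -> F) m :
  (forall k, a k != 0) -> b 0%N = a 0%N ->
  (forall k, b k.+1 = a k.+1 * a k) -> a m = 1 ->
  \prod_(k < m.+1) b k ^ (k%:Z * (-1) ^+ k.+1) =
  \prod_(k < m) a k ^ ((-1) ^+ k).
Proof.
move=> a0 b0 bS am.
suff -> : \prod_(k < m.+1) b k ^ (k%:Z * (-1) ^+ k.+1) =
    \prod_(k < m) a k ^ ((-1) ^+ k) * a m ^ (m%:Z * (-1) ^+ m.+1).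
  by rewrite am exp1rz mulr1.
elim: m {am} => [|m IHm]; first by rewrite big_ord1 big_ord0 !mul0r !expr0z mul1r.
rewrite big_ord_recr /= IHm big_ord_recr /= bS expfzMl.
rewrite -!mulrA; congr (_ * _); rewrite mulrCA [RHS]mulrC; congr (_ * _).
rewrite -expfzDr //; congr (_ ^ _).
by rewrite !exprS -addn1 PoszD; ring.
Qed.

Lemma Det0 (C : numClosedFieldType) n : Det (0 : 'M[C]_n) = 1.
Proof.
have -> : (0 : 'M[C]_n) = (0 : 'M_(n, 0)) *m (0 : 'M_(0, n)) by rewrite mulmx0.
by rewrite Det_mulmxC Det_unit ?det_mx00 // oner_neq0.
Qed.

(** The image of [N] is a kernel, and the kernel of an integer matrix is closed under division. *)
Lemma exact_saturated p f q (M : 'M[int]_(p, f)) (N : 'M[int]_(f, q)) :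
  M *m N = 0 -> (forall v : 'cV_f, M *m v = 0 -> exists w, v = N *m w) ->
  saturated N.
Proof.
move=> MN ex c v w c0 vw; apply: ex.
have : c *: (M *m v) = 0 by rewrite scalemxAr vw mulmxA MN mul0mx.
move/colP => Mv0; apply/colP => i; have /eqP := Mv0 i.
by rewrite !mxE mulf_eq0 (negPf c0) => /eqP.
Qed.

Section ExactComplex.
Variables (C : numClosedFieldType) (N : nat -> nat).
Variables (D : forall j, 'M[int]_(N j, N j.+1)) (m q : nat).
Variables (T : 'M[int]_(N m.+1, q)) (H : unimod_fact T).
Hypothesis DD : forall j, D j *m D j.+1 = 0.
Hypothesis exact0 : forall v : 'cV_(N 0%N), exists w, v = D 0 *m w.
Hypothesis exactS : forall j (v : 'cV_(N j.+1)),
  (j < m)%N -> D j *m v = 0 -> exists w, v = D j.+1 *m w.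
Hypothesis DT : D m *m T = 0.
Hypothesis exactT : forall v : 'cV_(N m.+1), D m *m v = 0 -> exists w, v = T *m w.

Let DC j : 'M[C]_(N j, N j.+1) := map_mx intr (D j).

Lemma exact_unimod_fact j : (j <= m)%N -> unimod_fact (D j).
Proof.
case: j => [_|j jm]; apply: saturated_unimod_fact.
  by apply: (@exact_saturated 0 _ _ 0); rewrite ?mul0mx // => v _; apply: exact0.
by apply: (@exact_saturated _ _ _ (D j)) => // v; apply: exactS.
Qed.

Let F j (jm : (j <= m)%N) := exact_unimod_fact jm.

(** The factorization [F] depends on a proof of j <= m. The default 1 extends its Gram determinants
    to all j without introducing zeros. *)
Let gl j : C :=
  if (j <= m)%N =P true is ReflectT jm then (gram_l (F jm))%:~R else 1.
Let gr j : C :=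
  if (j <= m)%N =P true is ReflectT jm then (gram_r (F jm))%:~R else 1.

Let glE j (jm : (j <= m)%N) : gl j = (gram_l (F jm))%:~R.
Proof. by rewrite /gl; case: eqP => // jm'; rewrite (bool_irrelevance jm jm'). Qed.

Let grE j (jm : (j <= m)%N) : gr j = (gram_r (F jm))%:~R.
Proof. by rewrite /gr; case: eqP => // jm'; rewrite (bool_irrelevance jm jm'). Qed.

(** [T] closes the complex at the top: it is the next boundary map for an acyclic complex, and the
    column of the fundamental cycle for a sphere. *)
Lemma exact_complex_Det :
  \prod_(k < m) Det (DC k.+1 *m (DC k.+1)^T) ^ ((-1) ^+ k) =
  Det (DC 0 *m (DC 0)^T) * (gram_l H)%:~R ^ ((-1) ^+ m.+1).
Proof.
have gr0 j : gr j != 0.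
  rewrite /gr; case: eqP => [jm|_]; last exact: oner_neq0.
  by rewrite intr_eq0 gram_r_neq0.
have grl j : (j < m)%N -> gr j = gl j.+1.
  move=> jm; rewrite (grE (ltnW jm)) (glE jm); congr (_%:~R).
  by apply: gram_exact => // v; apply: exactS.
have aE j (jm : (j <= m)%N) : Det (DC j *m (DC j)^T) = gl j * gr j.
  by rewrite (Det_unimod_fact C (F jm)) -glE -grE.
transitivity (\prod_(k < m) (gl k.+1 * gr k.+1) ^ ((-1) ^+ k)).
  by apply: eq_bigr => k _; rewrite aE.
rewrite alternating_telescope // aE //; congr (_ * _ ^ _); last first.
  by rewrite (grE (leqnn m)); congr (_%:~R); apply: gram_exact.
(* The complex is continued by the zero map below degree 0, where the Gram determinant is that of an
   empty matrix. *)
have H0 : unimod_fact (0 : 'M[int]_(0, N 0)).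
  by apply: saturated_unimod_fact => c v w _ _; exists 0; rewrite [v]flatmx0 mul0mx.
have -> : gl 0 = 1; last by rewrite mul1r.
rewrite (glE (leq0n m)) -(@gram_exact _ _ _ _ _ H0) ?mul0mx //.
rewrite /gram_r; have := mulmx1_min (uf_lK H0); rewrite leqn0 => /eqP r0.
by move: (uf_r H0); rewrite r0 => B; rewrite det_mx00.
Qed.

End ExactComplex.

(** * Simplicial chains *)

Section Chains.
Variables (G : sgraph) (le : rel G).
Hypotheses (le_total : total le) (le_anti : antisymmetric le).

Implicit Types (u v w : G) (x y : {set G}).

Definition chain := {ffun {set G} -> int}.
Implicit Types f g : chain.

(** Since [position] ignores v itself, this is the sign of v in v |: y, whether or not v lies in
    y. *)
Definition vsign y v : int := (-1) ^+ position le y v.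

Lemma vsign_sq y v : vsign y v * vsign y v = 1.
Proof. by rewrite -expr2 sqrr_sign. Qed.

Lemma vsign0 v : vsign set0 v = 1.
Proof.
suff e : position le set0 v = 0%N by rewrite /vsign e.
by apply: eq_card0 => w; rewrite !inE.
Qed.

Lemma vsign_setU1_id y v : vsign (v |: y) v = vsign y v.
Proof.
suff e : position le (v |: y) v = position le y v by rewrite /vsign e.
by apply: eq_card => w; rewrite !inE; case: eqVneq; rewrite ?andbF.
Qed.

Lemma vsign_setU1 y u v : u != v -> u \notin y ->
  vsign (u |: y) v = vsign y v * (if le u v then -1 else 1).
Proof.
move=> uv uy.
suff e : position le (u |: y) v = (le u v + position le y v)%N.
  by rewrite /vsign e exprD mulrC; case: (le u v).
rewrite /position (cardsD1 u) !inE eqxx uv /=; congr (_ + _)%N.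
apply: eq_card => w; rewrite !inE; case: eqVneq => //= ->.
by rewrite (negPf uy).
Qed.

Lemma le_alt u v : u != v -> le v u = ~~ le u v.
Proof.
move=> uv; case luv: (le u v); last by have := le_total u v; rewrite luv.
apply/negP => lvu; move/eqP: uv; apply.
by apply: le_anti; rewrite luv lvu.
Qed.

(* In exterior-algebra notation, [cut v] is the contraction with v, [ext v] the
   multiplication by v on the left, and the boundary is the sum of all
   contractions. The empty set is a simplex of dimension -1, so that homology
   is reduced homology. *)
Definition cut v f : chain :=
  [ffun y : {set G} => if v \in y then 0 else vsign y v * f (v |: y)].

Definition ext v f : chain :=
  [ffun y : {set G} => if v \in y then vsign y v * f (y :\ v) else 0].

Definition boundary f : chain := \sum_v cut v f.

Lemma cut_additive v : {morph cut v : f g / f + g}.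
Proof.
by move=> f g; apply/ffunP => y; rewrite !ffunE; case: ifP; rewrite ?addr0 ?mulrDr.
Qed.

Lemma cut0 v : cut v 0 = 0.
Proof. by apply/ffunP => y; rewrite !ffunE; case: ifP; rewrite ?mulr0. Qed.

Lemma cutN v f : cut v (- f) = - cut v f.
Proof. by apply/ffunP => y; rewrite !ffunE; case: ifP; rewrite ?oppr0 ?mulrN. Qed.

Lemma ext_additive v : {morph ext v : f g / f + g}.
Proof.
by move=> f g; apply/ffunP => y; rewrite !ffunE; case: ifP; rewrite ?addr0 ?mulrDr.
Qed.

Lemma ext0 v : ext v 0 = 0.
Proof. by apply/ffunP => y; rewrite !ffunE; case: ifP; rewrite ?mulr0. Qed.

Lemma boundaryD f g : boundary (f + g) = boundary f + boundary g.
Proof. by rewrite -big_split; apply: eq_bigr => v _; rewrite cut_additive. Qed.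

Lemma boundaryN f : boundary (- f) = - boundary f.
Proof. by rewrite -sumrN; apply: eq_bigr => v _; rewrite cutN. Qed.

Lemma boundaryB f g : boundary (f - g) = boundary f - boundary g.
Proof. by rewrite boundaryD boundaryN. Qed.

Lemma boundary0 : boundary 0 = 0.
Proof. by rewrite /boundary big1 // => v _; rewrite cut0. Qed.

Lemma boundaryMz f (a : int) : boundary (f *~ a) = boundary f *~ a.
Proof.
have bM n : boundary (f *+ n) = boundary f *+ n.
  by elim: n => [|n IHn]; rewrite ?mulr0n ?boundary0 // !mulrS boundaryD IHn.
by case: a => n; rewrite ?NegzE ?mulrNz ?boundaryN -!pmulrn bM.
Qed.

Lemma boundaryE f y :
  boundary f y = \sum_(v | v \notin y) vsign y v * f (v |: y).
Proof.
rewrite sum_ffunE [RHS]big_mkcond; apply: eq_bigr => v _ /=.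
by rewrite ffunE if_neg.
Qed.

Lemma cutC u v f : cut u (cut v f) = - cut v (cut u f).
Proof.
apply/ffunP => y; rewrite !ffunE !inE.
case: (eqVneq u v) => [->|uv].
  by rewrite ?eqxx /= mulr0 if_same oppr0.
case: ifP => uy; first by rewrite orbT mulr0 if_same oppr0.
rewrite /=; case: ifP => vy; first by rewrite mulr0 oppr0.
rewrite setUCA !vsign_setU1 ?uy ?vy //; last by rewrite eq_sym.
rewrite (le_alt uv); case: (le u v) => /=; ring.
Qed.

Lemma cut_ext u v f : u != v -> cut u (ext v f) = - ext v (cut u f).
Proof.
move=> uv; have vu : v != u by rewrite eq_sym.
apply/ffunP => y; rewrite !ffunE !inE (negPf uv) (negPf vu) /=.
case: ifP => uy; first by rewrite mulr0 if_same oppr0.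
case: ifP => vy; last by rewrite mulr0 oppr0.
rewrite vsign_setU1 ?uy // -{1 3}(setD1K vy) vsign_setU1 ?setD11 //.
have -> : (u |: (v |: y :\ v)) :\ v = u |: y :\ v.
  apply/setP => w; rewrite !inE; case: (eqVneq w v) => //= ->.
  by rewrite (negPf vu).
rewrite (le_alt uv); case: (le u v) => /=; ring.
Qed.

(** The Clifford relation: the first term lives on the sets without v, the second on those with
    v. *)
Lemma cut_ext_id v f : cut v (ext v f) + ext v (cut v f) = f.
Proof.
apply/ffunP => y; rewrite !ffunE !inE eqxx /=; case: ifP => vy.
  rewrite add0r setD1K // -{1}(setD1K vy) vsign_setU1_id.
  by rewrite mulrA vsign_sq mul1r.
rewrite addr0 vsign_setU1_id setU1K ?vy // mulrA vsign_sq mul1r //.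
Qed.

Lemma cut_boundary v f : cut v (boundary f) = - boundary (cut v f).
Proof.
rewrite /boundary (big_morph _ (cut_additive v) (cut0 v)) -sumrN.
by apply: eq_bigr => u _; rewrite cutC.
Qed.

(** Contractions anticommute, so the double sum equals its own negative. *)
Lemma boundary_boundary f : boundary (boundary f) = 0.
Proof.
have bbE : boundary (boundary f) = \sum_v \sum_u cut v (cut u f).
  by apply: eq_bigr => v _; rewrite (big_morph _ (cut_additive v) (cut0 v)).
have e : boundary (boundary f) = - boundary (boundary f).
  rewrite bbE -sumrN [LHS]exchange_big; apply: eq_bigr => v _ /=.
  by rewrite -sumrN; apply: eq_bigr => u _; rewrite cutC.
apply/ffunP => y; move/ffunP/(_ y): e; rewrite !ffunE.
by move: (boundary (boundary f) y : int) => z ze; lia.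
Qed.

(** Coning with apex v is a contracting homotopy. *)
Lemma boundary_ext v f : boundary (ext v f) = f - ext v (boundary f).
Proof.
rewrite /boundary (big_morph _ (ext_additive v) (ext0 v)).
rewrite (bigD1 v) //= [in RHS](bigD1 v) //= opprD addrA; congr (_ + _).
  by apply/eqP; rewrite eq_sym subr_eq cut_ext_id.
by rewrite -sumrN; apply: eq_bigr => u uv; rewrite cut_ext.
Qed.

End Chains.

(** * Acyclic clique complexes *)

Section CliqueComplexes.
Variables (G : sgraph) (le : rel G).
Hypotheses (le_total : total le) (le_anti : antisymmetric le).

Implicit Types (u v w : G) (x y : {set G}) (A B : {set G}) (f g : chain G).

Local Notation bd := (boundary le).
Local Notation cut := (cut le).
Local Notation ext := (ext le).

Definition clique_in A x : bool :=
  (x \subset A) && [forall u in x, forall v in x, (u != v) ==> adj u v].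

Lemma clique_inP A x :
  reflect (x \subset A /\ {in x &, forall u v, u != v -> adj u v}) (clique_in A x).
Proof.
apply: (iffP andP) => -[xA xc]; split=> //.
  move=> u v ux vx uv; move/forall_inP: xc => /(_ u ux)/forall_inP/(_ v vx).
  by move/implyP; apply.
by apply/forall_inP => u ux; apply/forall_inP => v vx; apply/implyP; apply: xc.
Qed.

Lemma clique_in_sub A x y : y \subset x -> clique_in A x -> clique_in A y.
Proof.
move=> yx /clique_inP[xA xc]; apply/clique_inP; split.
  exact: subset_trans xA.
by move=> u v uy vy; apply: xc; apply: (subsetP yx).
Qed.

Lemma clique_inS A B x : A \subset B -> clique_in A x -> clique_in B x.
Proof. by move=> AB /andP[xA xc]; rewrite /clique_in (subset_trans xA AB). Qed.

Lemma clique_in0 A : clique_in A set0.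
Proof. by apply/clique_inP; split=> [|u v]; rewrite ?sub0set ?inE. Qed.

Definition link A v := [set w in A | adj v w].

Lemma link_sub A v : link A v \subset A :\ v.
Proof.
apply/subsetP => w; rewrite !inE => /andP[-> vw]; rewrite andbT.
by apply/eqP => wv; rewrite wv adj_irr in vw.
Qed.

Lemma clique_in_link_notin A v x : clique_in (link A v) x -> v \notin x.
Proof.
case/andP=> /subsetP xl _; apply/negP => /xl.
by rewrite inE adj_irr andbF.
Qed.

Lemma clique_in_setU1 A v y : v \notin y ->
  clique_in A (v |: y) = (v \in A) && clique_in (link A v) y.
Proof.
move=> vy; apply/clique_inP/andP => [[yA yc]|[vA /clique_inP[yA yc]]].
  move: yA; rewrite subUset sub1set => /andP[vA /subsetP yA]; split=> //.
  apply/clique_inP; split=> [|u w uy wy]; last by apply: yc; rewrite inE ?uy ?wy orbT.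
  apply/subsetP => w wy; rewrite inE yA //= yc ?inE ?eqxx ?wy ?orbT //.
  by apply: contraNneq vy => ->.
have adjv w : w \in y -> adj v w by move/(subsetP yA); rewrite inE => /andP[].
split.
  rewrite subUset sub1set vA (subset_trans yA) //.
  by apply/subsetP => w; rewrite inE => /andP[].
move=> u w; rewrite !inE => /predU1P[->|uy] /predU1P[->|wy] uw.
- by rewrite eqxx in uw.
- exact: adjv.
- by rewrite adj_sym adjv.
- exact: yc.
Qed.

Lemma clique_in_set1 A v : clique_in A [set v] = (v \in A).
Proof.
by rewrite -[[set v]]setU0 clique_in_setU1 ?inE // clique_in0 andbT.
Qed.

Lemma clique_in_setD1 A v x : clique_in (A :\ v) x = (v \notin x) && clique_in A x.
Proof. by rewrite /clique_in subsetD1 -andbA andbCA. Qed.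

Definition supported A f : Prop := forall x, ~~ clique_in A x -> f x = 0.

Lemma supportedS A B f : A \subset B -> supported A f -> supported B f.
Proof. by move=> AB Af x xB; apply: Af; apply: contraNN xB; apply: clique_inS. Qed.

Lemma supportedD A f g : supported A f -> supported A g -> supported A (f + g).
Proof. by move=> Af Ag x xA; rewrite ffunE Af // Ag // addr0. Qed.

Lemma supportedN A f : supported A f -> supported A (- f).
Proof. by move=> Af x xA; rewrite ffunE Af // oppr0. Qed.

Lemma supported0 A : supported A 0.
Proof. by move=> x _; rewrite ffunE. Qed.

Lemma chainMzE f (a : int) x : (f *~ a) x = f x * a.
Proof.
have fM n : (f *+ n) x = f x * n%:Z by rewrite ffunMnE -mulr_natr natz.
by case: a => n; rewrite ?NegzE ?mulrNz -?pmulrn ?ffunE fM ?mulrN.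
Qed.

Lemma supportedMz A f a : supported A f -> supported A (f *~ a).
Proof. by move=> Af x xA; rewrite chainMzE Af // mul0r. Qed.

Lemma supported_boundary A f : supported A f -> supported A (bd f).
Proof.
move=> Af x xA; rewrite boundaryE big1 // => v _; rewrite Af ?mulr0 //.
by apply: contraNN xA; apply: clique_in_sub; apply: subsetUr.
Qed.

Lemma supported_cut A v f : supported A f -> supported (link A v) (cut v f).
Proof.
move=> Af x xA; rewrite ffunE; case: ifPn => // vx; rewrite Af ?mulr0 //.
by rewrite clique_in_setU1 // (negPf xA) andbF.
Qed.

Lemma supported_ext A v f : v \in A -> supported (link A v) f -> supported A (ext v f).
Proof.
move=> vA Af x xA; rewrite ffunE; case: ifPn => // vx; rewrite Af ?mulr0 //.
by apply: contraNN xA => xl; rewrite -(setD1K vx) clique_in_setU1 ?setD11 // vA.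
Qed.

(** [cut v f] records, up to sign, the values of [f] on the sets containing v. *)
Lemma supported_cut0 A v f : supported A f -> cut v f = 0 -> supported (A :\ v) f.
Proof.
move=> Af cf x; rewrite clique_in_setD1 negb_and negbK => /orP[vx|]; last exact: Af.
move/ffunP/(_ (x :\ v)): cf; rewrite !ffunE setD11 setD1K // => /eqP.
by rewrite mulf_eq0 signr_eq0 => /eqP.
Qed.

Lemma cut_supportedD1 A v f : supported (A :\ v) f -> cut v f = 0.
Proof.
move=> Af; apply/ffunP => x; rewrite !ffunE; case: ifP => // _.
by rewrite Af ?mulr0 // clique_in_setD1 !inE eqxx.
Qed.

Lemma cut_ext_link A v f : supported (link A v) f -> cut v (ext v f) = f.
Proof.
move=> Af; rewrite -[RHS](cut_ext_id le v f).
by rewrite (cut_supportedD1 (supportedS (link_sub A v) Af)) ext0 addr0.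
Qed.

Definition acyclic_in A : Prop :=
  forall f, supported A f -> bd f = 0 -> exists2 g, supported A g & bd g = f.

(** For a cycle f, the contraction [cut v f] is a cycle of the link, hence the boundary of some g
    there. Adding the boundary of [ext v g] clears all simplices through v and leaves a cycle of A \
    v. *)
Lemma acyclic_cone A v : v \in A ->
  acyclic_in (link A v) -> acyclic_in (A :\ v) -> acyclic_in A.
Proof.
move=> vA aL aD f Af f0.
have [|g Lg gE] := aL _ (supported_cut (v := v) Af).
  by apply/eqP; rewrite -eqr_opp -cut_boundary // f0 cut0 oppr0.
have Ag := supported_ext vA Lg.
have [||h Dh hE] := aD (f + bd (ext v g)).
- apply: supported_cut0; first exact: supportedD Af (supported_boundary Ag).
  by rewrite cut_additive cut_boundary // (cut_ext_link Lg) gE subrr.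
- by rewrite boundaryD f0 boundary_boundary // addr0.
exists (h - ext v g); last by rewrite boundaryB hE addrK.
by apply: supportedD (supportedN Ag); apply: supportedS Dh; apply: subD1set.
Qed.

(** A filling g in A of a cycle that avoids v has a contraction [cut v g] that is a cycle of the
    link. Filling it there by h, the boundary of [ext v h] corrects g to a filling that avoids v. *)
Lemma acyclic_cone_inv A v : v \in A ->
  acyclic_in (link A v) -> acyclic_in A -> acyclic_in (A :\ v).
Proof.
move=> vA aL aA f Df f0.
have [|g Ag gE] := aA _ _ f0; first by apply: supportedS Df; apply: subD1set.
have [|h Lh hE] := aL _ (supported_cut (v := v) Ag).
  apply/eqP; rewrite -eqr_opp -cut_boundary // gE (cut_supportedD1 Df).
  by rewrite oppr0.
have Ah := supported_ext vA Lh.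
exists (g + bd (ext v h)); last by rewrite boundaryD boundary_boundary // addr0.
apply: supported_cut0; first exact: supportedD Ag (supported_boundary Ah).
by rewrite cut_additive cut_boundary // (cut_ext_link Lh) hE subrr.
Qed.

Lemma acyclic_set1 v : acyclic_in [set v].
Proof.
move=> f Af f0; have vv : v \in [set v] by rewrite inE.
(* The boundary at the empty set is the augmentation. What remains of f sits on the empty set and is
   filled by coning. *)
have fv : f [set v] = 0.
  move/ffunP/(_ set0): f0; rewrite boundaryE ffunE (bigD1 v) ?inE //= big1.
    by rewrite addr0 setU0 => /eqP; rewrite mulf_eq0 signr_eq0 => /eqP.
  by move=> w /andP[_ wv]; rewrite setU0 Af ?mulr0 // clique_in_set1 inE.
have Lf : supported (link [set v] v) f.
  move=> x xL; have [vx|vx] := boolP (v \in x).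
    have [xv|xv] := boolP (clique_in [set v] x); last exact: Af.
    suff -> : x = [set v] by [].
    apply/eqP; rewrite eqEsubset sub1set vx andbT; by case/andP: xv.
  apply: Af; apply: contraNN xL => /andP[xv _]; apply/clique_inP.
  have -> : x = set0; last by split=> [|u w]; rewrite ?sub0set ?inE.
  apply/setP => w; rewrite inE; apply/negP => wx; move/subsetP/(_ w wx): xv.
  by rewrite inE => /eqP wv; rewrite -wv wx in vx.
exists (ext v f); first exact: supported_ext.
by rewrite boundary_ext // f0 ext0 subr0.
Qed.

(** [unit_sphere] and [remove_vertex] change the vertex type; through full embeddings the inductions
    on them speak of subsets of the fixed graph [G]. *)
Definition embedding (H : sgraph) (p : H -> G) : Prop :=
  injective p /\ forall u v : H, adj (p u) (p v) = adj u v.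

Lemma embedding_val (H : sgraph) (p : H -> G) (B : {set H}) :
  embedding p -> @embedding (induced B) (p \o val).
Proof.
move=> [pI pa]; split=> [u v /pI/val_inj|u v] //.
by rewrite /= pa.
Qed.

Lemma image_induced (H : sgraph) (p : H -> G) (B : {set H}) :
  (p \o val) @: [set: induced B] = p @: B.
Proof.
apply/setP => w; apply/imsetP/imsetP => -[u].
  by move=> _ ->; exists (val u) => //; apply: valP.
by move=> uB ->; exists (exist _ u uB); rewrite ?inE.
Qed.

Lemma image_unit_sphere (H : sgraph) (p : H -> G) : embedding p ->
  forall v : H, (p \o val) @: [set: unit_sphere v] = link (p @: [set: H]) (p v).
Proof.
move=> [pI pa] v; rewrite image_induced; apply/setP => w; rewrite inE.
apply/imsetP/andP => [[u]|[/imsetP[u _ ->]]].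
  by rewrite inE => vu ->; rewrite imset_f ?inE // pa.
by rewrite pa => vu; exists u; rewrite ?inE.
Qed.

Lemma image_remove_vertex (H : sgraph) (p : H -> G) : embedding p ->
  forall v : H, (p \o val) @: [set: remove_vertex v] = (p @: [set: H]) :\ p v.
Proof.
move=> [pI pa] v; rewrite image_induced; apply/setP => w; rewrite !inE.
apply/imsetP/andP => [[u]|[wv /imsetP[u _ wu]]].
  by rewrite !inE => uv ->; rewrite imset_f ?inE // (inj_eq pI).
by exists u; rewrite // !inE -(inj_eq pI) -wu.
Qed.

Lemma contractible_acyclic (H : sgraph) : contractible H ->
  forall p : H -> G, embedding p -> acyclic_in (p @: [set: H]).
Proof.
elim=> {H} [H H1|H v _ IHS _ IHR] p pE.
  have /cards1P[u ->] : #|[set: H]| == 1%N by rewrite cardsT H1.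
  by rewrite imset_set1; apply: acyclic_set1.
apply: (@acyclic_cone _ (p v)); first by rewrite imset_f ?inE.
  by rewrite -image_unit_sphere //; apply/IHS/embedding_val.
by rewrite -image_remove_vertex //; apply/IHR/embedding_val.
Qed.

End CliqueComplexes.

(** Connectedness is phrased as propagation of properties along edges. In the inductive step the
    unit sphere is non-empty and supplies a neighbour s joining v to the rest. *)
Lemma contractible_connected (H : sgraph) : contractible H ->
  (0 < #|H|)%N /\
  forall P : pred H, (forall u w, adj u w -> P u -> P w) -> forall u w, P u -> P w.
Proof.
elim=> {H} [H H1|H v _ [S0 _] _ [R0 RP]].
  split=> [|P _ u w]; first by rewrite H1.
  by move/eqP/fintype1P: H1 => [z zE]; rewrite (zE u) (zE w).
split=> [|P Padj]; first by apply/card_gt0P; exists v.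
have /card_gt0P[s _] := S0; have sP := valP s; rewrite inE in sP.
have PR u w : u != v -> w != v -> P u -> P w.
  move=> uv wv; have uv' : u \in [set~ v] by rewrite !inE.
  have wv' : w \in [set~ v] by rewrite !inE.
  apply: (RP (fun z : remove_vertex v => P (val z)) _ (exist _ u uv') (exist _ w wv')).
  by move=> a b; apply: Padj.
have sv : val s != v by apply: contraTneq sP => ->; rewrite adj_irr.
have Pv u : P u -> P v.
  have [->//|uv] := eqVneq u v => Pu; apply: (Padj (val s)); first by rewrite adj_sym.
  exact: PR Pu.
have Pv' w : P v -> P w.
  have [->//|wv] := eqVneq w v => Pw; apply: (PR (val s)) => //.
  exact: Padj Pw.
by move=> u w /Pv/Pv'.
Qed.

(** * Spheres and homotopy invariance *)

Section Spheres.
Variables (G : sgraph) (le : rel G).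
Hypotheses (le_total : total le) (le_anti : antisymmetric le).

Implicit Types (u v w : G) (x y : {set G}) (A B : {set G}) (f g phi : chain G).

Local Notation bd := (boundary le).
Local Notation cut := (cut le).
Local Notation ext := (ext le).

Definition pure_in n A : Prop :=
  (forall x, clique_in A x -> exists y, [/\ clique_in A y, x \subset y & #|y| = n]) /\
  (forall x, clique_in A x -> (#|x| <= n)%N).

(** The pseudomanifold condition: each ridge lies in exactly two facets. *)
Definition thin_in n A : Prop :=
  forall y, clique_in A y -> #|y|.+1 = n ->
    #|[set v | (v \notin y) && clique_in A (v |: y)]| = 2.

(** The last clause concerns cycles of all degrees at once: the whole reduced homology is generated
    by the class of [phi], which sits in top degree. *)
Definition fundamental_cycle n A phi : Prop :=
  [/\ supported A phi, bd phi = 0,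
      forall x, #|x| != n -> phi x = 0,
      forall x, clique_in A x -> #|x| = n -> absz (phi x) = 1%N &
      forall f, supported A f -> bd f = 0 ->
        exists a g, supported A g /\ f = phi *~ a + bd g].

(* [n] is the number of vertices of a facet, so the dimension is n - 1. *)
Definition sphere_in n A : Prop :=
  [/\ pure_in n A, thin_in n A & exists phi, fundamental_cycle n A phi].

Definition component k f : chain G :=
  [ffun x : {set G} => if #|x| == k then f x else 0].

Lemma supported_component k A f : supported A f -> supported A (component k f).
Proof. by move=> Af x xA; rewrite ffunE Af // if_same. Qed.

Lemma boundary_component k f : bd (component k.+1 f) = component k (bd f).
Proof.
apply/ffunP => y; rewrite ffunE !boundaryE; case: ifP => yk.
  by apply: eq_bigr => v vy; rewrite ffunE cardsU1 vy eqSS yk.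
by rewrite big1 // => v vy; rewrite ffunE cardsU1 vy eqSS yk mulr0.
Qed.

Lemma absz_vsign x v (a : int) : absz (vsign le x v * a) = absz a.
Proof. by rewrite abszM abszX /= exp1n mul1n. Qed.

Lemma pure_top n A f x : pure_in n A -> supported A f -> (n <= #|x|)%N -> bd f x = 0.
Proof.
move=> [_ dimA] Af xn; rewrite boundaryE big1 // => v vx.
rewrite Af ?mulr0 //; apply/negP => /dimA; rewrite cardsU1 vx.
by rewrite ltnNge xn.
Qed.

(** Boundaries vanish in top degree, so there a cycle is an honest multiple of [phi]. *)
Lemma fundamental_cycle_top n A phi f : pure_in n A -> fundamental_cycle n A phi ->
  supported A f -> bd f = 0 ->
  exists a, forall x, (n <= #|x|)%N -> f x = phi x * a.
Proof.
move=> pA [_ _ _ _ gen] Af f0; have [a [g [Ag ->]]] := gen f Af f0.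
exists a => x xn; rewrite ffunE (pure_top pA Ag xn) addr0 chainMzE //.
Qed.

(** * Spheres from spherical links and an acyclic complement of one vertex *)

Section Suspension.
Variables (n : nat) (A : {set G}) (v0 : G).
Hypotheses (v0A : v0 \in A) (links : forall v, v \in A -> sphere_in n (link A v)).
Hypothesis acyc : acyclic_in le (A :\ v0).
Hypothesis A_gt : exists w, w \in A :\ v0.
Hypothesis conn : forall P : pred G,
  {in A :\ v0 &, forall u w, adj u w -> P u -> P w} ->
  {in A :\ v0 &, forall u w, P u -> P w}.

Lemma suspension_pure : pure_in n.+1 A.
Proof.
split=> x xA.
  have [v vA xl] : exists2 v, v \in A & clique_in (link A v) (x :\ v).
    have [->|[v vx]] := set_0Vmem x.
      by exists v0; rewrite // set0D clique_in0.
    have := xA; rewrite -{1}(setD1K vx) clique_in_setU1 ?setD11 // => /andP[vA xl].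
    by exists v.
  have [[/(_ _ xl)[y [yl xy yn]] _] _ _] := links vA.
  have vy := clique_in_link_notin yl; exists (v |: y); split.
  - by rewrite clique_in_setU1 // vA.
  - by rewrite -subDset.
  - by rewrite cardsU1 vy yn.
have [->|[v vx]] := set_0Vmem x; first by rewrite cards0.
have := xA; rewrite -{1}(setD1K vx) clique_in_setU1 ?setD11 // => /andP[vA xl].
have [[_ /(_ _ xl) xn] _ _] := links vA.
by rewrite (cardsD1 v) vx.
Qed.

(** Empty links mean that there are no edges, so connectedness leaves a single vertex besides v0. *)
Lemma suspension0 : n = 0%N -> exists2 w, w != v0 & A = [set v0; w].
Proof.
move=> n0; have [w wA] := A_gt; exists w; first by move: wA; rewrite !inE => /andP[].
have noadj u z : u \in A -> z \in A -> ~~ adj u z.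
  move=> uA zA; apply/negP => uz; have [[_ dim] _ _] := links uA.
  have := dim [set z]; rewrite n0 cards1 clique_in_set1 inE zA uz => /(_ isT).
  by rewrite ltn0.
have allw z : z \in A :\ v0 -> z = w.
  move=> zA; apply/eqP; apply: (conn (P := pred1 w) _ wA zA) => //=.
  move=> a b aA bA ab; exfalso; move: ab; apply/negP; apply: noadj.
    by move: aA; rewrite inE => /andP[].
  by move: bA; rewrite inE => /andP[].
apply/setP => z; rewrite !inE; case: (eqVneq z v0) => [->//|zv] /=.
apply/idP/eqP => [zA|->]; first by apply: allw; rewrite !inE zv.
by move: wA; rewrite inE => /andP[].
Qed.

(** The cofaces of a ridge y through w correspond to those of y \ w in the link of w; only the empty
    ridge needs the two-point case. *)
Lemma suspension_thin : thin_in n.+1 A.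
Proof.
move=> y yA [yn]; have [y0|[w wy]] := set_0Vmem y.
  rewrite y0 cards0 in yn *; have [w wv AE] := suspension0 (esym yn).
  rewrite (_ : [set _ | _] = A) ?AE ?cards2 1?eq_sym ?wv //.
  by apply/setP => v; rewrite inE setU0 clique_in_set1 inE.
have := yA; rewrite -{1}(setD1K wy) clique_in_setU1 ?setD11 // => /andP[wA yl].
have [_ thw _] := links wA.
rewrite -(thw _ yl); last by rewrite -yn (cardsD1 w y) wy.
apply: eq_card => v; rewrite !inE; case: (eqVneq v w) => [->|vw] /=.
  rewrite wy /=; apply/esym/negP => /clique_in_link_notin.
  by rewrite !inE eqxx.
case vy: (v \in y) => //=.
have wvy : w \notin v |: y :\ w by rewrite !inE eq_sym (negPf vw) eqxx.
by rewrite -{1}(setD1K wy) setUCA clique_in_setU1 // wA.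
Qed.

(** The cycle is glued from the cone with apex v0 over the fundamental cycle of the link and a
    filling of that cycle in A \ v0. *)
Lemma suspension_cycle : exists phi, fundamental_cycle n.+1 A phi.
Proof.
have [pL _ [phiL FL]] := links v0A; have [LphiL phiL0 phiLn phiL1 genL] := FL.
have DphiL := supportedS (link_sub A v0) LphiL.
have AphiL := supported_ext le v0A LphiL.
have [psi' Dpsi' psi'E] := acyc DphiL phiL0.
(* The filling need not be homogeneous; only its part in top degree is kept. *)
pose psi := component n.+1 psi'.
have Dpsi : supported (A :\ v0) psi by apply: supported_component.
have psiE : bd psi = phiL.
  rewrite boundary_component psi'E; apply/ffunP => x; rewrite ffunE.
  by case: (eqVneq #|x| n) => // /phiLn ->.
pose phi := ext v0 phiL - psi.
have Aphi : supported A phi.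
  by apply: supportedD => //; apply/supportedN/supportedS/Dpsi/subD1set.
have phi0 : bd phi = 0.
  by rewrite boundaryB boundary_ext // phiL0 ext0 subr0 psiE subrr.
have phin x : #|x| != n.+1 -> phi x = 0.
  move=> xn; rewrite !ffunE (negPf xn) subr0; case: ifP => // vx.
  rewrite phiLn ?mulr0 //; apply: contraNneq xn => <-.
  by rewrite (cardsD1 v0 x) vx.
have cut_phi : cut v0 phi = phiL.
  by rewrite cut_additive cutN (cut_ext_link le LphiL)
    (cut_supportedD1 le Dpsi) oppr0 addr0.
(* Contracting [phi] with w gives a cycle of the link of w, hence in top degree a multiple of its
   fundamental cycle, whose coefficients are +-1. *)
have star w : w \in A -> exists a : nat, forall y, clique_in A y -> #|y| = n.+1 ->
    w \in y -> absz (phi y) = a.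
  move=> wA; have [pw _ [phiw Fw]] := links wA.
  have [|a aE] := fundamental_cycle_top pw Fw (supported_cut le (v := w) Aphi).
    by apply/eqP; rewrite -eqr_opp -cut_boundary // phi0 cut0 oppr0.
  exists (absz a) => y yA yn wy.
  have := yA; rewrite -{1}(setD1K wy) clique_in_setU1 ?setD11 // => /andP[_ yl].
  have ywn : #|y :\ w| = n by move: yn; rewrite (cardsD1 w) wy => -[].
  have := aE (y :\ w); rewrite ywn leqnn => /(_ isT)/(congr1 absz).
  rewrite ffunE setD11 setD1K // absz_vsign abszM => ->.
  by have [_ _ _ -> //] := Fw; rewrite mul1n.
pose P w := [forall y, (clique_in A y && (#|y| == n.+1) && (w \in y)) ==>
                        (absz (phi y) == 1%N)].
(* By purity an edge lies in a facet, which belongs to both stars. *)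
have Padj u w : u \in A -> w \in A -> adj u w -> P u -> P w.
  move=> uA wA uw /forallP Pu; have uwA : clique_in A [set u; w].
    by rewrite clique_in_setU1 ?clique_in_set1 !inE ?wA ?uA ?uw //;
      apply: contraTneq uw => ->; rewrite adj_irr.
  have [/(_ _ uwA)[y [yA uwy yn]] _] := suspension_pure.
  have uy : u \in y by apply: (subsetP uwy); rewrite !inE eqxx.
  have wy : w \in y by apply: (subsetP uwy); rewrite !inE eqxx orbT.
  have /implyP := Pu y; rewrite yA yn eqxx uy => /(_ isT)/eqP phiy.
  have [a aE] := star w wA; apply/forallP => z; apply/implyP => /andP[/andP[zA /eqP zn] wz].
  by rewrite (aE z) // -(aE y) // phiy.
have Pv0 : P v0.
  apply/forallP => y; apply/implyP => /andP[/andP[yA /eqP yn] vy].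
  rewrite !ffunE vy (Dpsi' y) ?clique_in_setD1 ?vy // if_same subr0 absz_vsign.
  have := yA; rewrite -{1}(setD1K vy) clique_in_setU1 ?setD11 // => /andP[_ yl].
  by rewrite phiL1 //; move: yn; rewrite (cardsD1 v0) vy => -[].
have PA w : w \in A -> P w.
  (* Without edges nothing spreads from star to star; there the augmentation makes the two
     coefficients opposite. *)
  have [n0|n_gt0] := posnP n.
    have [z zv AE] := suspension0 n0.
    rewrite AE !inE => /pred2P[]-> //.
    apply/forallP => y; apply/implyP => /andP[/andP[yA /eqP yn] zy].
    have -> : y = [set z].
      apply/esym/eqP; rewrite eqEcard sub1set zy cards1 yn n0 //.
    move/ffunP/(_ set0): phi0; rewrite boundaryE ffunE (bigD1 z) ?inE //=.
    rewrite (bigD1 v0) ?inE 1?eq_sym //= big1 => [|u /andP[/andP[_ uz] uv]]; last first.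
      by rewrite setU0 Aphi ?mulr0 // clique_in_set1 AE !inE negb_or uz uv.
    rewrite addr0 !setU0 => /eqP; rewrite addr_eq0 => /eqP/(congr1 absz).
    rewrite abszN !absz_vsign => ->.
    move/forallP/(_ [set v0]): Pv0; rewrite clique_in_set1 v0A cards1 n0 !inE.
    by rewrite !eqxx /= eq_sym.
  have [[/(_ _ (clique_in0 _))[y [yl _ yn]] _] _ _] := links v0A.
  have [s sy] : exists s, s \in y by apply/card_gt0P; rewrite yn.
  have := subsetP (proj1 (andP yl)) s sy; rewrite inE => /andP[sA vs].
  have Ps : P s by apply: Padj Pv0.
  have sD : s \in A :\ v0.
    by rewrite !inE sA andbT; apply: contraTneq vs => ->; rewrite adj_irr.
  have [->//|wv] := eqVneq w v0 => wA; apply: (conn (P := P) _ sD) => //.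
    by move=> a b; rewrite !inE => /andP[_ aA] /andP[_ bA]; apply: Padj.
  by rewrite !inE wv.
exists phi; split=> // [x xA xn|f Af f0].
  have [w wx] : exists w, w \in x by apply/card_gt0P; rewrite xn.
  have wA := subsetP (proj1 (andP xA)) w wx.
  by move/forallP/(_ x)/implyP: (PA w wA); rewrite xA xn eqxx wx => /(_ isT)/eqP.
have [|a [g1 [Lg1 g1E]]] := genL _ (supported_cut le (v := v0) Af).
  by apply/eqP; rewrite -eqr_opp -cut_boundary // f0 cut0 oppr0.
have Ag1 := supported_ext le v0A Lg1.
have cutMz (h : chain G) : cut v0 (h *~ a) = cut v0 h *~ a.
  apply/ffunP => x; rewrite !(ffunE, chainMzE); case: ifP => _; first by rewrite mul0r.
  by rewrite mulrA.
(* On the link of v0 the cycle f contracts to a multiple of [phiL] plus a boundary. Subtracting the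
   same multiple of [phi] and coning the boundary away leaves a cycle of the acyclic part. *)
have [||h Dh hE] := acyc (f := f - phi *~ a + bd (ext v0 g1)).
- apply: (supported_cut0 (le := le)).
    apply: supportedD; last exact: supported_boundary.
    by apply: supportedD => //; apply/supportedN/supportedMz.
  rewrite 2!cut_additive cutN cutMz cut_phi cut_boundary //.
  rewrite (cut_ext_link le Lg1) g1E.
  by rewrite [_ *~ a + _]addrC addrK subrr.
- by rewrite boundaryD boundaryB boundaryMz f0 phi0 boundary_boundary // mul0rz subrr addr0.
exists a, (h - ext v0 g1); split.
  by apply: supportedD (supportedN Ag1); apply: supportedS Dh; apply: subD1set.
by rewrite boundaryB hE addrK addrC subrK.
Qed.

Lemma suspension_sphere : sphere_in n.+1 A.
Proof.
split; [exact: suspension_pure | exact: suspension_thin | exact: suspension_cycle].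
Qed.

End Suspension.

Lemma sphere_in0 : sphere_in 0 set0.
Proof.
have clique0 x : clique_in set0 x = (x == set0).
  apply/idP/eqP => [/andP[]|->]; last exact: clique_in0.
  by rewrite subset0 => /eqP.
split=> //; first split=> x.
- by rewrite clique0 => /eqP ->; exists set0; rewrite clique_in0 cards0.
- by rewrite clique0 => /eqP ->; rewrite cards0.
exists [ffun x : {set G} => (x == set0)%:R]; split.
- by move=> x; rewrite clique0 ffunE => /negPf ->.
- apply/ffunP => y; rewrite boundaryE ffunE big1 // => v vy.
  by rewrite ffunE setU_eq0 -cards_eq0 cards1 mulr0.
- by move=> x; rewrite cards_eq0 ffunE => /negPf ->.
- by move=> x; rewrite clique0 ffunE => /eqP ->; rewrite eqxx.
move=> f Af f0; exists (f set0), 0; split; first exact: supported0.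
rewrite boundary0 addr0; apply/ffunP => x; rewrite chainMzE ffunE.
have [->|x0] := eqVneq x set0; rewrite ?mul1r ?mul0r //.
by rewrite Af // clique0.
Qed.

Lemma sphere_succ_sphere_in n (H : sgraph) : sphere_succ n H ->
  forall p : H -> G, embedding p -> sphere_in n (p @: [set: H]).
Proof.
elim: n H => [|n IHn] H /=.
  move=> H0 p pE; have -> : [set: H] = set0; last by rewrite imset0; apply: sphere_in0.
  by apply/eqP; rewrite -cards_eq0 cardsT H0.
move=> [HS [v Hv]] p pE; set A := p @: _.
have AE w : w \in A -> exists u : H, w = p u by case/imsetP => u _; exists u.
have [HR0 HR] := contractible_connected Hv.
have DE := image_remove_vertex pE v.
have /card_gt0P[z _] := HR0.
apply: (@suspension_sphere _ _ (p v)).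
- by rewrite imset_f ?inE.
- move=> w /AE[u ->]; rewrite -image_unit_sphere //.
  by apply: IHn (HS u) _ _; apply: embedding_val.
- by rewrite -DE; apply: (contractible_acyclic le_total le_anti Hv); apply: embedding_val.
- by exists (p (val z)); rewrite -DE; apply/imsetP; exists z; rewrite ?inE.
move=> P Padj u w; rewrite -DE => /imsetP[u' _ ->] /imsetP[w' _ ->].
apply: (HR (fun t => P (p (val t)))) => a b ab; apply: Padj; rewrite -?DE.
- by apply/imsetP; exists a; rewrite ?inE.
- by apply/imsetP; exists b; rewrite ?inE.
- by case: pE => _ ->.
Qed.

End Spheres.

(** * Transport of chains along order-preserving embeddings *)

Section Transport.
Variables (H G : sgraph) (leH : rel H) (leG : rel G) (p : H -> G).
Hypotheses (pE : embedding p) (p_le : forall u v, leG (p u) (p v) = leH u v).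

Let pI : injective p := proj1 pE.

Lemma vsign_imset (x : {set H}) v : vsign leG (p @: x) (p v) = vsign leH x v.
Proof.
suff e : position leG (p @: x) (p v) = position leH x v by rewrite /vsign e.
rewrite /position -(card_imset _ pI); apply: eq_card => w; rewrite inE.
apply/andP/imsetP => [[/imsetP[u ux ->]]|[u]].
  by rewrite p_le (inj_eq pI) => uv; exists u; rewrite ?inE ?ux.
by rewrite !inE => /andP[ux uv] ->; rewrite imset_f // p_le (inj_eq pI).
Qed.

Lemma clique_in_imset (B x : {set H}) : clique_in (p @: B) (p @: x) = clique_in B x.
Proof.
apply/clique_inP/clique_inP => -[xB xc]; split=> [|u v].
- apply/subsetP => u ux; have /imsetP[w wB] := subsetP xB (p u) (imset_f p ux).
  by move/pI->.
- move=> ux vx uv; case: pE => _ <-; apply: xc; rewrite ?imset_f //.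
  by rewrite (inj_eq pI).
- exact: imsetS.
move=> /imsetP[a ax ->] /imsetP[b bx ->]; rewrite (inj_eq pI) => ab.
by case: pE => _ ->; apply: xc.
Qed.

Lemma clique_in_imset_preim (B : {set H}) (y : {set G}) :
  clique_in (p @: B) y -> p @: (p @^-1: y) = y.
Proof.
move=> /andP[/subsetP yB _]; apply/setP => w; apply/imsetP/idP => [[u]|wy].
  by rewrite inE => uy ->.
by have /imsetP[u uB wu] := yB w wy; exists u; rewrite // inE -wu.
Qed.

Definition pull_chain (f : chain G) : chain H := [ffun x : {set H} => f (p @: x)].

(** The test selects the sets contained in the image of [p]. *)
Definition push_chain (f : chain H) : chain G :=
  [ffun y : {set G} => if p @: (p @^-1: y) == y then f (p @^-1: y) else 0].

Lemma pull_push f : pull_chain (push_chain f) = f.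
Proof.
apply/ffunP => x; rewrite !ffunE.
have -> : p @^-1: (p @: x) = x by apply/setP => u; rewrite inE mem_imset.
by rewrite eqxx.
Qed.

Lemma push_pull (B : {set H}) f : supported (p @: B) f -> push_chain (pull_chain f) = f.
Proof.
move=> Bf; apply/ffunP => y; rewrite !ffunE; case: eqP => [->//|yn].
by rewrite Bf //; apply/negP => /clique_in_imset_preim.
Qed.

Lemma supported_pull (B : {set H}) f : supported (p @: B) f -> supported B (pull_chain f).
Proof. by move=> Bf x xB; rewrite ffunE Bf // clique_in_imset. Qed.

Lemma supported_push B f : supported B f -> supported (p @: B) (push_chain f).
Proof.
move=> Bf y yB; rewrite ffunE; case: eqP => // yE.
by rewrite Bf // -clique_in_imset yE.
Qed.

Lemma boundary_pull (B : {set H}) f : supported (p @: B) f ->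
  boundary leH (pull_chain f) = pull_chain (boundary leG f).
Proof.
move=> Bf; apply/ffunP => x; rewrite ffunE !boundaryE.
have outside (w : G) : w \notin p @: (~: x) -> w \notin p @: x -> f (w |: p @: x) = 0.
  move=> w1 w2; apply: Bf; apply/negP => /andP[/subsetP/(_ w)]; rewrite !inE eqxx.
  move=> /(_ isT)/imsetP[u _ wu]; move: w1 w2; rewrite wu !mem_imset // inE.
  by case: (u \in x).
rewrite [RHS](bigID (mem (p @: (~: x)))) /= [X in _ + X]big1 ?addr0; last first.
  by move=> w /andP[w2 w1]; rewrite outside ?mulr0.
transitivity (\sum_(w in p @: (~: x)) vsign leG (p @: x) w * f (w |: p @: x)).
  rewrite big_imset; last by move=> u v _ _ /pI.
  apply: eq_big => [v|v vx]; first by rewrite !inE.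
  by rewrite vsign_imset ffunE imsetU1.
apply: eq_bigl => w; apply/idP/andP => [|[]//] wx; split=> //.
by case/imsetP: wx => u; rewrite !inE => ux ->; rewrite mem_imset.
Qed.

Lemma acyclic_pull (B : {set H}) :
  acyclic_in leG (p @: B) -> acyclic_in leH B.
Proof.
move=> aB f Bf f0; have Pf := supported_push Bf.
have [|g Pg gE] := aB _ Pf.
  rewrite -[LHS](push_pull (supported_boundary leG Pf)) -(boundary_pull Pf).
  by rewrite pull_push f0; apply/ffunP => y; rewrite !ffunE if_same.
exists (pull_chain g); first exact: supported_pull.
by rewrite (boundary_pull Pg) gE pull_push.
Qed.

Lemma acyclic_push (B : {set H}) :
  acyclic_in leH B -> acyclic_in leG (p @: B).
Proof.
move=> aB f Pf f0; have [|g Bg gE] := aB _ (supported_pull Pf).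
  by rewrite (boundary_pull Pf) f0; apply/ffunP => x; rewrite !ffunE.
have Pg := supported_push Bg; exists (push_chain g) => //.
rewrite -[LHS](push_pull (supported_boundary leG Pg)) -(boundary_pull Pg).
by rewrite pull_push gE (push_pull Pf).
Qed.

End Transport.

Lemma embedding_id (G : sgraph) : embedding (@id G).
Proof. by split. Qed.

(** Added vertices leave any ambient graph fixed in advance, so the order is quantified inside the
    induction and chains are transported between the graphs. *)
Lemma homotopic_to_one_acyclic (G : sgraph) : homotopic_to_one G ->
  forall le : rel G, total le -> antisymmetric le -> acyclic_in le [set: G].
Proof.
elim=> {G} [G G1|G v vS _ IH|G A AC _ IH] le le_total le_anti.
- have /cards1P[u ->] : #|[set: G]| == 1%N by rewrite cardsT G1.
  exact: acyclic_set1.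
- have id_im := imset_id [set: G].
  have vE := embedding_val [set~ v] (embedding_id G).
  apply: (@acyclic_cone _ _ le_total le_anti _ v); first by rewrite inE.
    rewrite -[X in link X]id_im -(image_unit_sphere (embedding_id G)).
    by apply/(contractible_acyclic le_total le_anti vS)/embedding_val/embedding_id.
  rewrite -[X in X :\ _]id_im -(image_remove_vertex (embedding_id G)).
  apply: (@acyclic_push (remove_vertex v) G (fun a b => le (val a) (val b))) => //.
  apply: IH => [a b|a b /le_anti/val_inj //]; exact: le_total.
(* The new vertex becomes the largest one. *)
pose le' : rel (add_vertex A) := fun a b =>
  match a, b with Some a, Some b => le a b | _, None => true | None, Some _ => false end.
have le'_total : total le' by case=> [a|] [b|] //=; apply: le_total.
have le'_anti : antisymmetric le'.
  by case=> [a|] [b|] //= /le_anti ->.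
have someE : @embedding (add_vertex A) G Some by split=> // u v [].
apply: (@acyclic_pull G (add_vertex A) le le' Some) => //.
have -> : Some @: [set: G] = [set: add_vertex A] :\ None.
  apply/setP => -[u|]; rewrite !inE; first by rewrite imset_f ?in_setT.
  by apply/imsetP => -[].
apply: acyclic_cone_inv => //.
  have -> : link [set: add_vertex A] None = (Some \o val) @: [set: induced A].
    rewrite (@image_induced (add_vertex A) G Some A).
    apply/setP => -[u|]; rewrite !inE /=.
      by rewrite mem_imset // => a b [].
    by apply/esym/imsetP => -[].
  by apply: (contractible_acyclic le'_total le'_anti AC); apply: embedding_val.
exact: IH.
Qed.

(** * Spanning trees given by parent functions *)

Section ParentTree.
Variables (H : sgraph) (r : H).
Implicit Types (u v w : H) (F : {set {set H}}).

Definition parent_spec F (p : H -> H) (rk : H -> nat) : Prop :=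
  forall u, u != r -> span_adj F u (p u) /\ (rk (p u) < rk u)%N.

Definition parent_edges (p : H -> H) : {set {set H}} :=
  [set [set u; p u] | u in [set~ r]].

(** The rank is the length of a shortest walk to the root, and the parent is the next vertex on such
    a walk. *)
Lemma connected_parent F : connected (spanning_subgraph F) ->
  exists p rk, parent_spec F p rk.
Proof.
move=> /andP[_ /forallP conF].
have walk u : exists n, [exists s : n.-tuple H, path (span_adj F) u s && (last u s == r)].
  have /connectP[s us rs] := forallP (conF u) r.
  by exists (size s); apply/existsP; exists (in_tuple s); rewrite us /= -rs eqxx.
pose rk u := ex_minn (walk u).
have step u : exists w, u != r -> span_adj F u w && (rk w < rk u)%N.
  rewrite {2}/rk; case: ex_minnP => n /existsP[s /andP[us /eqP ls]] _.
  case: s us ls => -[|w s] /= sn us ls; first by exists u; rewrite ls eqxx.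
  exists w => _; case/andP: us => -> ws; rewrite -(eqP sn) /= ltnS.
  rewrite /rk; case: ex_minnP => k _; apply; apply/existsP.
  by exists (in_tuple s); rewrite ws /= ls eqxx.
have [p pP] := fin_all_exists step.
by exists p, rk => u /pP /andP[].
Qed.

Section Parent.
Variables (F : {set {set H}}) (p : H -> H) (rk : H -> nat).
Hypothesis pP : parent_spec F p rk.

Lemma parent_neq u : u != r -> p u != u.
Proof. by move=> /pP[_]; apply: contraTneq => ->; rewrite ltnn. Qed.

(** Two vertices sharing their edge would be each other's parent, with each rank below the other. *)
Lemma parent_edge_inj : {in [set~ r] &, injective (fun u => [set u; p u])}.
Proof.
move=> u v; rewrite !inE => ur vr uv; apply/eqP/negPn/negP => nuv.
have : u \in [set v; p v] by rewrite -uv !inE eqxx.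
have : v \in [set u; p u] by rewrite uv !inE eqxx.
rewrite !inE (negPf nuv) eq_sym (negPf nuv) /= => /eqP vE /eqP uE.
have [_ l1] := pP ur; have [_ l2] := pP vr.
by rewrite -vE in l1; rewrite -uE in l2; have := ltn_trans l1 l2; rewrite ltnn.
Qed.

Lemma card_parent_edges : #|parent_edges p|.+1 = #|H|.
Proof.
rewrite card_in_imset; last exact: parent_edge_inj.
by rewrite cardsC1 prednK //; apply/card_gt0P; exists r.
Qed.

Lemma parent_edges_sub : parent_edges p \subset F.
Proof.
by apply/subsetP => e /imsetP[u]; rewrite !inE => /pP[/andP[_ ue] _] ->.
Qed.

Lemma parent_connect u v : connect (span_adj (parent_edges p)) u v.
Proof.
have sym : connect_sym (span_adj (parent_edges p)) by apply/sym_connect_sym/span_sym.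
have toroot w : connect (span_adj (parent_edges p)) w r.
  elim: {w}_.+1 {-2}w (ltnSn (rk w)) => // k IHk w wk.
  have [->|wr] := eqVneq w r; first exact: connect0.
  have [/andP[wp _] lt] := pP wr.
  apply: connect_trans (connect1 _) (IHk (p w) (leq_trans lt wk)).
  by rewrite /span_adj wp; apply/imsetP; exists w; rewrite ?inE.
by apply: connect_trans (toroot u) _; rewrite sym.
Qed.

Lemma parent_edges_adj u v : span_adj (parent_edges p) u v ->
  (u != r /\ v = p u) \/ (v != r /\ u = p v).
Proof.
case/andP=> uv /imsetP[w]; rewrite !inE => wr uvE.
have : u \in [set w; p w] by rewrite -uvE !inE eqxx.
have : v \in [set w; p w] by rewrite -uvE !inE eqxx orbT.
rewrite !inE => /pred2P[] vE /pred2P[] uE.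
- by rewrite uE vE eqxx in uv.
- by right; rewrite uE vE.
- by left; rewrite uE vE.
- by rewrite uE vE eqxx in uv.
Qed.

(* On a cycle, both neighbours of a vertex of maximal rank are its parent. *)
Lemma parent_acyclic : acyclic (spanning_subgraph (parent_edges p)).
Proof.
apply/acyclicP => s /andP[cs us]; rewrite leqNgt; apply/negP => s2.
have [x0 x0s] : exists x, x \in s by case: s s2 {cs us} => // x s; exists x; rewrite mem_head.
have [x xs xmax] := @arg_maxnP _ x0 (mem s) rk x0s.
have [i t tE] := rot_to xs.
have ct : path (span_adj (parent_edges p)) x (rcons t x).
  by have : path.cycle (span_adj (parent_edges p)) (x :: t) by rewrite -tE rot_cycle.
have ut : uniq (x :: t) by rewrite -tE rot_uniq.
have st : (2 < size (x :: t))%N by rewrite -tE size_rot.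
have tmax w : w \in t -> (rk w <= rk x)%N.
  by move=> wt; apply: xmax; rewrite /= -(mem_rot i) tE inE wt orbT.
have nbr w : w \in t -> span_adj (parent_edges p) x w -> w = p x.
  move=> wt /parent_edges_adj[[]//|[wr xE]].
  by have [_] := pP wr; rewrite -xE ltnNge tmax.
case: t {tE} ct ut st tmax nbr => // a t; case/lastP: t => // t b ct ut _ tmax nbr.
have := ct; rewrite /= rcons_path last_rcons => /andP[xa /andP[_ bx]].
have ea := nbr a (mem_head _ _) xa.
have eb : b = p x.
  by apply: nbr; [rewrite inE mem_rcons mem_head orbT | rewrite span_sym].
by move: ut; rewrite /= ea -eb mem_rcons mem_head andbF.
Qed.

(** A further edge of [F] would close a path of parent edges to a cycle. *)
Lemma acyclic_parent_edges : acyclic (spanning_subgraph F) ->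
  F \subset simplices H 1 -> F = parent_edges p.
Proof.
move=> /acyclicP acF FE; apply/eqP; rewrite eqEsubset parent_edges_sub andbT.
apply/subsetP => e eF; apply/negPn/negP => eP.
have := subsetP FE e eF.
rewrite inE => /andP[_ /cards2P[a [b [ab eE]]]].
have /connectP[s0 abp lb] := parent_connect a b.
case/shortenP: abp lb => s abp us _ lb.
have sF : path (span_adj F) a s.
  apply: sub_path abp => u v /andP[uv uvP].
  by rewrite /span_adj uv (subsetP parent_edges_sub).
have cyc : ucycle (span_adj F) (a :: s).
  rewrite /ucycle us andbT /= rcons_path sF /= -lb /span_adj eq_sym ab.
  by rewrite setUC -eE.
have := acF _ cyc; case: s abp us lb {sF cyc} => [|c [|d s]] //=.
  by move=> _ _ ba; rewrite ba eqxx in ab.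
rewrite andbT => ac _ bc _; move: eP; rewrite eE bc.
by case/andP: ac => _ ->.
Qed.

Lemma parent_spanning_tree : F \subset simplices H 1 -> spanning_tree (parent_edges p).
Proof.
move=> FE; apply/andP; split; first exact: subset_trans parent_edges_sub FE.
apply/andP; split; last exact: parent_acyclic.
apply/andP; split; first by apply/card_gt0P; exists r.
by apply/forallP => u; apply/forallP => v; apply: parent_connect.
Qed.

Variables (R : comNzRingType) (n : nat) (rho : 'I_n -> H).
Hypothesis rhoB : bijective rho.

(** The matrix is unitriangular with respect to the rank. A permutation with non-zero product never
    raises the rank; as it preserves the sum of all ranks, it is the identity. *)
Lemma det_parent_mx :
  \det (\matrix_(i, j) (if rho i == r then (rho j == r)%:R
         else (rho j == rho i)%:R - (rho j == p (rho i))%:R) : 'M[R]_n) = 1.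
Proof.
have rhoI := bij_inj rhoB; set Q := \matrix_(i, j) _.
rewrite /determinant (bigD1 1%g) //= odd_perm1 mul1r [X in X + _]big1; last first.
  move=> i _; rewrite perm1 mxE eqxx; have [//|ir] := eqVneq (rho i) r.
  by rewrite eq_sym (negPf (parent_neq ir)) subr0.
rewrite big1 ?addr0 // => s s1; suff [i Qi] : exists i, Q i (s i) = 0.
    by rewrite (bigD1 i) //= Qi mul0r mulr0.
  apply/'exists_eqP; apply: contraNT s1 => /existsPn Q0.
  have le_rk i : (rk (rho (s i)) <= rk (rho i) ?= iff (s i == i))%N.
    have := Q0 i; rewrite mxE; have [ir|ir] := eqVneq (rho i) r.
      rewrite -ir (inj_eq rhoI); case: (eqVneq (s i) i) => [-> _|]; last by rewrite eqxx.
      exact: leqif_refl.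
    rewrite (inj_eq rhoI); case: (eqVneq (s i) i) => [-> _|_]; first exact: leqif_refl.
    case: (eqVneq (rho (s i)) (p (rho i))) => [sE _|]; last by rewrite subrr eqxx.
    have [_ lt] := pP ir; split; first by rewrite sE ltnW.
    by rewrite sE ltn_eqF.
  have [_] := leqif_sum (fun i (_ : true) => le_rk i).
  have sumE : (\sum_i rk (rho (s i)) = \sum_i rk (rho i))%N.
    by rewrite [RHS](reindex_perm s).
  rewrite sumE eqxx => /esym/forallP s_id.
  by apply/eqP/permP => i; rewrite perm1; apply/eqP; have := s_id i.
Qed.

End Parent.
End ParentTree.

(** * The matrix-tree theorem *)

Lemma det0_left_kernel (F : fieldType) n (M : 'M[F]_n) (z : 'rV_n) :
  z != 0 -> z *m M = 0 -> \det M = 0.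
Proof.
move=> z0 zM; apply/eqP/negPn/negP => M0; case/eqP: z0.
have uM : M \in unitmx by rewrite unitmxE unitfE.
by rewrite -[z](mulmxK uM) zM mul0mx.
Qed.

Section MatrixTree.
Variables (C : numClosedFieldType) (H : sgraph) (r : H).
Variables (n : nat) (rho : 'I_n -> H).
Hypothesis rhoB : bijective rho.

Let rhoI : injective rho := bij_inj rhoB.

Let rho_surj u : exists i, u = rho i.
Proof. by have [g gK rK] := rhoB; exists (g u); rewrite rK. Qed.

Let card_rho : #|H| = n.
Proof. by rewrite -(bij_eq_card rhoB) card_ord. Qed.

Let sum_rho (V : nmodType) (F : H -> V) : \sum_i F (rho i) = \sum_u F u.
Proof. by rewrite [RHS](reindex rho) //; apply: onW_bij. Qed.

Let sum_diff (F : H -> C) u v :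
  \sum_w F w * ((w == u)%:R - (w == v)%:R) = F u - F v.
Proof.
have pick1 z : \sum_w F w * (w == z)%:R = F z.
  rewrite (bigD1 z) //= eqxx mulr1 big1 ?addr0 // => w /negPf->.
  by rewrite mulr0.
by under eq_bigr => w _ do rewrite mulrBr; rewrite sumrB !pick1.
Qed.

Definition edge_tail (e : {set H}) : H := odflt r [pick u in e].

(* The rows of an oriented incidence matrix; the index [None] stands for an
   additional edge joining the root to a grounded vertex. *)
Definition edge_vec (k : option {set H}) (u : H) : C :=
  if k is Some e then
    if (e \in simplices H 1) && (u \in e) then
      if u == edge_tail e then 1 else -1
    else 0
  else (u == r)%:R.
Arguments edge_vec : simpl never.

Lemma edge_vecP e : e \in simplices H 1 ->
  exists u v, [/\ adj u v, e = [set u; v] &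
    forall w, edge_vec (Some e) w = (w == u)%:R - (w == v)%:R].
Proof.
move=> eE; have := eE; rewrite inE => /andP[/andP[_ /forall_inP ec] /cards2P[a [b [ab eab]]]].
have adjab u v : u \in e -> v \in e -> u != v -> adj u v.
  by move=> ue ve; apply/implyP; move/forall_inP: (ec u ue); apply.
have te : edge_tail e \in e.
  rewrite /edge_tail; case: pickP => //= e0.
  by have := e0 a; rewrite eab !inE eqxx.
suff [v [uv ev]] : exists v, edge_tail e != v /\ e = [set edge_tail e; v].
  exists (edge_tail e), v; split=> //.
    by apply: adjab; rewrite // ev !inE eqxx orbT.
  move=> w; rewrite /edge_vec eE /=; have [->|wt] := eqVneq w (edge_tail e).
    by rewrite te (negPf uv) subr0.
  have -> : (w \in e) = (w == v) by rewrite {1}ev !inE (negPf wt).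
  case: eqP => _; last by rewrite subrr.
  by rewrite sub0r.
have : edge_tail e \in [set a; b] by rewrite -eab.
rewrite !inE => /pred2P[]->; first by exists b.
by exists a; rewrite eq_sym ab setUC.
Qed.

Lemma edge_vec_nonedge e w : e \notin simplices H 1 -> edge_vec (Some e) w = 0.
Proof. by rewrite /edge_vec => /negPf ->. Qed.

Definition vmx (f : {ffun 'I_n -> option {set H}}) : 'M[C]_n :=
  \matrix_(i, j) edge_vec (f j) (rho i).

Definition grounded (F : {set {set H}}) : {set option {set H}} := None |: Some @: F.

Let groundedI : injective grounded.
Proof.
move=> F F' /setP e; apply/setP => x; have := e (Some x).
by rewrite /grounded !inE /= !mem_imset // => u v [].
Qed.

Let card_grounded F : #|grounded F| = #|F|.+1.
Proof.
rewrite cardsU1 card_imset ?add1n; last by move=> u v [].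
by case: imsetP => [[]|].
Qed.

Definition tree_supports : {set {set option {set H}}} :=
  [set grounded F | F in [set F | spanning_tree F]].

Lemma vmx_sqr (f : {ffun 'I_n -> option {set H}}) : injective f ->
  vmx f *m (vmx f)^T = \matrix_(i, j)
    \sum_(k in f @: [set: 'I_n]) edge_vec k (rho i) * edge_vec k (rho j).
Proof.
move=> fI; apply/matrixP => i j; rewrite !mxE big_imset /=; last by move=> a b _ _ /fI.
by apply: eq_big => [a|a _]; rewrite ?inE // !mxE.
Qed.

(** The edge vectors are the rows of the parent matrix [Q] up to sign, and the signs cancel in the
    products. *)
Lemma parent_gram (F : {set {set H}}) (p : H -> H) (rk : H -> nat) :
  F \subset simplices H 1 -> parent_spec r F p rk ->
  \det (\matrix_(i, j) \sum_(k in grounded (parent_edges r p))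
           edge_vec k (rho i) * edge_vec k (rho j)) = 1.
Proof.
move=> FE pP; pose Q : 'M[C]_n := \matrix_(i, j) (if rho i == r then (rho j == r)%:R
         else (rho j == rho i)%:R - (rho j == p (rho i))%:R).
have detQ : \det Q = 1 by exact: (det_parent_mx pP C rhoB).
have -> : (\matrix_(i, j) \sum_(k in grounded (parent_edges r p))
           edge_vec k (rho i) * edge_vec k (rho j)) = Q^T *m Q.
  apply/matrixP => i j; rewrite !mxE.
  rewrite big_setU1 /=; last by apply/imsetP => -[].
  rewrite big_imset /=; last by move=> a b _ _ [].
  rewrite big_imset /=; last exact: parent_edge_inj pP.
  under [RHS]eq_bigr => k _ do rewrite !mxE.
  pose q w u : C := if w == r then (u == r)%:R else (u == w)%:R - (u == p w)%:R.
  rewrite (sum_rho (fun w => q w (rho i) * q w (rho j))) [in RHS](bigD1 r) //= {1 2}/q eqxx.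
  congr (_ + _); apply: eq_big => [w|w wr]; first by rewrite !inE.
  rewrite !inE in wr; have [_ _] := pP w wr.
  have we : [set w; p w] \in parent_edges r p by apply/imsetP; exists w; rewrite ?inE.
  have := subsetP (subset_trans (parent_edges_sub pP) FE) _ we.
  case/edge_vecP=> u [v [uv wE uvE]].
  rewrite !uvE /q (negPf wr).
  have : u \in [set w; p w] by rewrite wE !inE eqxx.
  have : v \in [set w; p w] by rewrite wE !inE eqxx orbT.
  have nuv : u != v by apply: contraTneq uv => ->; rewrite adj_irr.
  rewrite !inE => /pred2P[] vE /pred2P[] uE; rewrite uE vE ?eqxx // in nuv *.
  by rewrite -[LHS]mulrNN !opprB.
by rewrite det_mulmx det_tr detQ mulr1.
Qed.

Lemma tree_support_det (f : {ffun 'I_n -> option {set H}}) :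
  injective f -> f @: [set: 'I_n] \in tree_supports ->
  \det (vmx f) ^+ 2 = 1.
Proof.
move=> fI /imsetP[F]; rewrite inE => sF fF.
have /andP[FE /andP[conF acF]] := sF.
have [p [rk pP]] := connected_parent r conF.
rewrite expr2 -{2}det_tr -det_mulmx vmx_sqr // fF (acyclic_parent_edges pP acF FE).
exact: parent_gram FE pP.
Qed.

(** Each defect of the support makes the determinant vanish: a repeated column, a zero column for a
    non-edge, the all-ones left kernel vector if the grounding edge is missing, the indicator of the
    vertices out of reach of r if the edges do not connect. Counting then leaves no edge besides the
    parent edges. *)
Lemma vmx_neq0_support (f : {ffun 'I_n -> option {set H}}) : \det (vmx f) != 0 ->
  injective f /\ f @: [set: 'I_n] \in tree_supports.
Proof.
move=> d0; have fI : injective f.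
  apply/injectiveP; apply: contraNT d0 => /injectivePn[a [b ab fab]].
  rewrite -det_tr; apply/eqP; apply: (determinant_alternate ab) => j.
  by rewrite !mxE fab.
split=> //; pose F := [set e | Some e \in f @: [set: 'I_n]].
have edgeF : F \subset simplices H 1.
  apply/subsetP => e; rewrite inE => /imsetP[j _ fj].
  apply: contraNT d0 => eE; rewrite -det_tr; apply/eqP.
  apply: (@det0_left_kernel _ _ _ (delta_mx 0 j)).
    by apply/eqP => /rowP/(_ j); rewrite !mxE !eqxx; apply/eqP/oner_neq0.
  by rewrite -rowE; apply/rowP => i; rewrite !mxE -fj edge_vec_nonedge.
have rootF : None \in f @: [set: 'I_n].
  apply: contraNT d0 => nF; apply/eqP.
  apply: (@det0_left_kernel _ _ _ (const_mx 1)).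
    have [i0 _] := rho_surj r.
    by apply/eqP => /rowP/(_ i0); rewrite !mxE; apply/eqP/oner_neq0.
  apply/rowP => j; rewrite !mxE; under eq_bigr => i _ do rewrite !mxE mul1r.
  rewrite (sum_rho (edge_vec (f j))); case fj: (f j) => [e|]; last first.
    by case/negP: nF; rewrite -fj imset_f ?inE.
  have [|u [v [_ _ eE]]] := @edge_vecP e.
    by apply: (subsetP edgeF); rewrite inE -fj imset_f ?inE.
  under eq_bigr => w _ do rewrite eE -[_ - _]mul1r.
  by rewrite (sum_diff (fun _ => 1)) subrr.
have fE : f @: [set: 'I_n] = grounded F.
  apply/setP => -[e|]; rewrite /grounded !inE /=; last by rewrite rootF.
  by rewrite mem_imset ?inE // => a b [].
have conF : connected (spanning_subgraph F).
  apply/andP; split; first by apply/card_gt0P; exists r.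
  have sym : connect_sym (span_adj F) by apply/sym_connect_sym/span_sym.
  suff toroot u : connect (span_adj F) r u.
    apply/forallP => u; apply/forallP => v.
    by apply: connect_trans (toroot v); rewrite sym.
  apply: contraNT d0 => ru; apply/eqP.
  pose z : 'rV[C]_n := \row_i (~~ connect (span_adj F) r (rho i))%:R.
  apply: (@det0_left_kernel _ _ _ z).
    have [i ui] := rho_surj u.
    by apply/eqP => /rowP/(_ i); rewrite !mxE -ui ru; apply/eqP/oner_neq0.
  apply/rowP => j; rewrite !mxE.
  pose z' w : C := (~~ connect (span_adj F) r w)%:R.
  under eq_bigr => i _ do rewrite !mxE.
  rewrite (sum_rho (fun w => z' w * edge_vec (f j) w)).
  case fj: (f j) => [e|]; last first.
    rewrite big1 // => w _; rewrite /edge_vec; case: eqP => [->|]; rewrite ?mulr0 //.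
    by rewrite /z' connect0 mul0r.
  have eF : e \in F by rewrite inE -fj imset_f ?inE.
  have [a [b [ab eab eE]]] := edge_vecP (subsetP edgeF e eF).
  under eq_bigr => w _ do rewrite eE.
  have z'ab : z' a = z' b.
    have nab : a != b by apply: contraTneq ab => ->; rewrite adj_irr.
    have Fab : connect (span_adj F) a b.
      by apply: connect1; rewrite /span_adj nab -eab.
    by rewrite /z' (same_connect_r sym Fab).
  by rewrite sum_diff z'ab subrr.
apply/imsetP; exists F; rewrite // inE.
have [p [rk pP]] := connected_parent r conF.
suff -> : F = parent_edges r p by apply: parent_spanning_tree pP edgeF.
apply/esym/eqP; rewrite eqEcard (parent_edges_sub pP).
rewrite -ltnS -card_grounded -fE card_imset // cardsT card_ord.
by rewrite (card_parent_edges pP) card_rho /=.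
Qed.

Lemma card_tree_supports : #|tree_supports| = #|[set F : {set {set H}} | spanning_tree F]|.
Proof. by rewrite card_imset. Qed.

Lemma tree_support_card T : T \in tree_supports -> #|T| = n.
Proof.
case/imsetP => F; rewrite inE => /andP[FE /andP[conF acF]] ->.
have [p [rk pP]] := connected_parent r conF.
by rewrite card_grounded (acyclic_parent_edges pP acF FE) (card_parent_edges pP).
Qed.

(** In the Cauchy-Binet sum every spanning tree contributes n! times 1, once for each ordering of
    its n grounded edges. *)
Lemma grounded_det :
  \det (\matrix_(i, j) \sum_k edge_vec k (rho i) * edge_vec k (rho j)) =
  #|[set F : {set {set H}} | spanning_tree F]|%:R.
Proof.
have n0 : n`!%:R != 0 :> C by rewrite pnatr_eq0 -lt0n fact_gt0.
apply: (mulIf n0); rewrite mulr_natr.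
rewrite (det_mulmx_ffun (fun i k => edge_vec k (rho i)) (fun i k => edge_vec k (rho i))).
rewrite -card_tree_supports -natrM.
pose good (f : {ffun 'I_n -> option {set H}}) :=
  injectiveb f && (f @: [set: 'I_n] \in tree_supports).
transitivity (\sum_(f | good f) (1 : C)).
  rewrite [RHS]big_mkcond; apply: eq_bigr => f _.
  rewrite -expr2 -/(vmx f); case: ifPn => [/andP[/injectiveP fI fT]|ngood].
    exact: tree_support_det.
  apply/eqP; rewrite sqrf_eq0; apply: contraNT ngood.
  by move=> /vmx_neq0_support[fI fT]; rewrite /good fT andbT; apply/injectiveP.
rewrite sumr_const; congr (_%:R).
rewrite -sum1_card (partition_big (fun f : {ffun _} => f @: [set: 'I_n])
  (mem tree_supports)) => [|f /andP[]] //=.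
rewrite -sum_nat_const; apply: eq_bigr => T TT; rewrite sum1dep_card.
have cT := tree_support_card TT.
transitivity (#|T| ^_ #|'I_n|); last by rewrite card_ord cT ffactnn.
rewrite -card_inj_ffuns_on.
apply: eq_card => f; rewrite !inE unfold_in /good.
apply/andP/andP => [[/andP[fI _] /eqP fT]|[/ffun_onP fT fI]].
  by split=> //; apply/ffun_onP => i; rewrite -fT imset_f ?inE.
have fTE : f @: [set: 'I_n] = T.
  apply/eqP; rewrite eqEcard cT card_imset; last exact/injectiveP.
  rewrite cardsT card_ord leqnn andbT.
  by apply/subsetP => k /imsetP[i _ ->]; apply: fT.
by rewrite fTE TT fI eqxx.
Qed.

End MatrixTree.

Arguments edge_vec : simpl never.

Lemma edge_simplex (H : sgraph) (u v : H) : adj u v -> [set u; v] \in simplices H 1.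
Proof.
move=> uv; have nuv : u != v by apply: contraTneq uv => ->; rewrite adj_irr.
rewrite inE cards2 nuv andbT; apply/andP; split.
  by apply/set0Pn; exists u; rewrite !inE eqxx.
apply/forall_inP => a ae; apply/forall_inP => b be; apply/implyP.
move: ae be; rewrite !inE => /pred2P[]-> /pred2P[]->; rewrite ?eqxx //.
by rewrite adj_sym.
Qed.

Section LaplacianTrees.
Variables (C : numClosedFieldType) (H : sgraph) (n : nat) (rho : 'I_n -> H).
Hypothesis rhoB : bijective rho.
Variable L : 'M[C]_n.
Hypothesis L_offdiag : forall i j, i != j -> L i j = - (adj (rho i) (rho j))%:R.
Hypothesis L_rowsum : forall i, \sum_j L i j = 0.

Let rhoI : injective rho := bij_inj rhoB.

Lemma laplacian_sym : L^T = L.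
Proof.
apply/matrixP => i j; rewrite mxE; have [->//|ij] := eqVneq i j.
by rewrite !L_offdiag // 1?eq_sym // adj_sym.
Qed.

Lemma laplacian_uniq (M : 'M[C]_n) :
  (forall i j, i != j -> M i j = L i j) -> (forall i, \sum_j M i j = 0) -> M = L.
Proof.
move=> Moff Mrow; apply/matrixP => i j; have [<-|/Moff//] := eqVneq i j.
have off : \sum_(k | k != i) M i k = \sum_(k | k != i) L i k.
  by apply: eq_bigr => k ki; rewrite Moff // eq_sym.
have := Mrow i; rewrite (bigD1 i) //= off => rows.
have := L_rowsum i; rewrite (bigD1 i) //= => rowsL.
by apply: (addIr (\sum_(k | k != i) L i k)); rewrite rows rowsL.
Qed.

Section Rooted.
Variable r : 'I_n.

Let edge_gram : 'M[C]_n := \matrix_(i, j)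
  \sum_(e : {set H}) edge_vec C (rho r) (Some e) (rho i) * edge_vec C (rho r) (Some e) (rho j).

Lemma edge_gram_laplacian : edge_gram = L.
Proof.
apply: laplacian_uniq => [i j ij|i].
  have nij : rho i != rho j by rewrite (inj_eq rhoI).
  rewrite mxE L_offdiag //; have [aij|naij] := boolP (adj (rho i) (rho j)); last first.
    rewrite oppr0 big1 // => e _; have [eE|eE] := boolP (e \in simplices H 1); last first.
      by rewrite edge_vec_nonedge // mul0r.
    have [u [v [uv eab ev]]] := edge_vecP C (rho r) eE; rewrite !ev.
    case: (eqVneq (rho i) u) => [iu|_]; case: (eqVneq (rho j) u) => [ju|_];
      case: (eqVneq (rho i) v) => [iv|_]; case: (eqVneq (rho j) v) => [jv|_];
      rewrite ?subrr ?mul0r ?mulr0 //; move: naij nij uv;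
      rewrite ?iu ?iv ?ju ?jv ?eqxx // 1?adj_sym; by do ?[case: (adj _ _) | case: (_ == _)].
  pose e0 := [set rho i; rho j].
  have e0E : e0 \in simplices H 1 by apply: edge_simplex.
  rewrite (bigD1 e0) //= big1 ?addr0 => [|e ee0].
    have [u [v [uv eab ev]]] := edge_vecP C (rho r) e0E; rewrite !ev.
    have nuv : u != v by apply: contraTneq uv => ->; rewrite adj_irr.
    have : rho i \in [set u; v] by rewrite -eab !inE eqxx.
    have : rho j \in [set u; v] by rewrite -eab !inE eqxx orbT.
    rewrite !inE => /pred2P[]je /pred2P[]ie; move: nij; rewrite ie je ?eqxx // => nij.
      by rewrite [v == u]eq_sym (negPf nuv) subr0 sub0r mulr1.
    by rewrite [v == u]eq_sym (negPf nuv) subr0 sub0r mul1r.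
  have [eE|eE] := boolP (e \in simplices H 1); last by rewrite edge_vec_nonedge // mul0r.
  have [ie|ie] := boolP (rho i \in e); last by rewrite {1}/edge_vec (negPf ie) andbF mul0r.
  have [je|je] := boolP (rho j \in e); last by rewrite {2}/edge_vec (negPf je) andbF mulr0.
  case/eqP: ee0; apply/esym/eqP; rewrite eqEcard subUset !sub1set ie je /=.
  by move: eE; rewrite inE cards2 nij => /andP[_ /eqP->].
under eq_bigr => j _ do rewrite mxE.
rewrite exchange_big big1 // => e _; rewrite -mulr_sumr.
have [eE|eE] := boolP (e \in simplices H 1); last by rewrite edge_vec_nonedge // mul0r.
have [u [v [uv eab ev]]] := edge_vecP C (rho r) eE.
have rhoE z : \sum_j (rho j == z)%:R = 1 :> C.
  have [g gK rK] := rhoB; rewrite (bigD1 (g z)) //= rK eqxx big1 ?addr0 // => j.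
  by apply: contraNeq; rewrite pnatr_eq0 eqb0 negbK => /eqP <-; rewrite gK.
under eq_bigr => j _ do rewrite ev.
by rewrite sumrB !rhoE subrr mulr0.
Qed.

Lemma det_grounded_laplacian :
  \det (L + delta_mx r r) = #|[set F : {set {set H}} | spanning_tree F]|%:R.
Proof.
rewrite -(grounded_det C (rho r) rhoB); congr (\det _).
apply/matrixP => i j; rewrite -edge_gram_laplacian !mxE.
pose t k := edge_vec C (rho r) k (rho i) * edge_vec C (rho r) k (rho j).
rewrite [RHS](bigD1 None) //= [LHS]addrC; congr (_ + _).
  by rewrite /edge_vec !(inj_eq rhoI) -natrM mulnb.
rewrite (reindex_omap Some id) => [|[e|]] //=.
by apply: eq_big => // e; rewrite eqxx.
Qed.

(** [X] satisfies L X = L and e^T X = 1^T, so it transforms L + e e^T into L plus the all-ones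
    matrix; its determinant is n. *)
Lemma det_laplacian_const :
  \det (L + const_mx 1) = n%:R ^+ 2 * \det (L + delta_mx r r).
Proof.
pose one : 'cV[C]_n := const_mx 1; pose e : 'cV[C]_n := delta_mx r 0.
pose X := 1%:M + one *m (one - e)^T.
have Lone : L *m one = 0.
  apply/colP => i; rewrite !mxE -[RHS](L_rowsum i).
  by apply: eq_bigr => j _; rewrite mxE mulr1.
have eone : e^T *m one = 1%:M.
  apply/matrixP => i j; rewrite trmx_delta -rowE !mxE (ord1 i) (ord1 j) eqxx //.
have oneone : one^T *m one = (n%:R)%:M.
  apply/matrixP => i j; rewrite !mxE (ord1 i) (ord1 j) eqxx mulr1n.
  under eq_bigr => k _ do rewrite !mxE mulr1.
  by rewrite sumr_const card_ord.
have detX : \det X = n%:R.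
  rewrite det_add1_mulmxC linearB /= mulmxBl eone oneone addrC subrK.
  by rewrite det_scalar1.
have LX : L *m X = L by rewrite mulmxDr mulmx1 mulmxA Lone mul0mx addr0.
have XL : X^T *m L = L by rewrite -[in LHS]laplacian_sym -trmx_mul LX laplacian_sym.
have eX : e^T *m X = one^T.
  by rewrite mulmxDr mulmx1 mulmxA eone mul1mx linearB /= addrC subrK.
clearbody X.
have -> : L + const_mx 1 = X^T *m (L + delta_mx r r) *m X.
  rewrite mulmxDr XL mulmxDl LX; congr (_ + _).
  have -> : delta_mx r r = e *m e^T by rewrite trmx_delta mul_delta_mx.
  rewrite mulmxA -[_ *m e *m _ *m _]mulmxA eX -[X^T *m e]trmxK trmx_mul trmxK eX.
  rewrite trmxK; apply/matrixP => i j; rewrite !mxE big_ord1 !mxE mulr1 //.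
rewrite !det_mulmx det_tr detX expr2; ring.
Qed.

End Rooted.

(** The all-ones matrix J is annihilated by L and has pseudo determinant n. Connectedness provides a
    spanning tree, so L + J is invertible with determinant n^2 times the number of trees; one factor
    n cancels and the other counts the roots. *)
Lemma Det_laplacian_connected : connected H -> Det L = #|rooted_spanning_trees H|%:R.
Proof.
move=> conH; have [/card_gt0P[u _] _] := andP conH.
have [r ru] : exists i, u = rho i by have [g gK rK] := rhoB; exists (g u); rewrite rK.
have n0 : n%:R != 0 :> C by rewrite pnatr_eq0 -lt0n (leq_ltn_trans _ (ltn_ord r)).
have tau0 : #|[set F : {set {set H}} | spanning_tree F]|%:R != 0 :> C.
  rewrite pnatr_eq0 -lt0n; apply/card_gt0P.
  have conE : connected (spanning_subgraph (simplices H 1)).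
    case/andP: conH => H0 /forallP conH'; apply/andP; split=> //.
    apply/forallP => a; apply/forallP => b.
    have /connectP[s sp ->] := forallP (conH' a) b; apply/connectP; exists s => //.
    apply: sub_path sp => x y xy; have nxy : x != y by apply: contraTneq xy => ->; rewrite adj_irr.
    by rewrite /= /span_adj nxy edge_simplex.
  have [p [rk pP]] := connected_parent u conE.
  by exists (parent_edges u p); rewrite inE; apply: parent_spanning_tree pP _.
have JE : (const_mx 1 : 'M[C]_n) = (const_mx 1 : 'cV_n) *m (const_mx 1 : 'rV_n).
  by apply/matrixP => i j; rewrite !mxE big_ord1 !mxE mulr1.
have DetJ : Det (const_mx 1 : 'M[C]_n) = n%:R.
  rewrite JE Det_mulmxC; have -> : (const_mx 1 : 'rV_n) *m const_mx 1 = (n%:R)%:M :> 'M[C]_1.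
    apply/matrixP => i j; rewrite !mxE (ord1 i) (ord1 j) eqxx mulr1n.
    under eq_bigr => k _ do rewrite !mxE mulr1.
    by rewrite sumr_const card_ord.
  by rewrite Det_unit det_scalar1.
have LJ : L *m const_mx 1 = 0 :> 'M_n.
  apply/matrixP => i j; rewrite !mxE -[RHS](L_rowsum i).
  by apply: eq_bigr => k _; rewrite mxE mulr1.
have cardH : #|H| = n by rewrite -(bij_eq_card rhoB) card_ord.
apply: (mulIf n0); rewrite -{1}DetJ -Det_addM // Det_unit.
  rewrite (det_laplacian_const r) det_grounded_laplacian.
  have -> : rooted_spanning_trees H = setX [set F | spanning_tree F] setT.
    by apply/setP => -[F v]; rewrite !inE andbT.
  by rewrite cardsX cardsT cardH natrM expr2; ring.
by rewrite (det_laplacian_const r) det_grounded_laplacian mulf_neq0 ?expf_neq0.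
Qed.

End LaplacianTrees.

(** * Boundary matrices and torsion *)

Section BoundaryMatrices.
Variables (G : sgraph) (le : rel G).
Hypotheses (le_total : total le) (le_anti : antisymmetric le).

Implicit Types (u : G) (x y : {set G}) (f g : chain G).

Local Notation bd := (boundary le).

(** The index is the number of vertices, one more than the dimension, so that [bdmx 0] is the
    augmentation. *)
Definition cells k : {set {set G}} :=
  if k is k'.+1 then simplices G k' else [set set0].
Arguments cells : simpl never.

Lemma simplex_clique x : simplex x = (x != set0) && clique_in [set: G] x.
Proof. by rewrite /simplex /clique_in subsetT. Qed.

Lemma mem_cells k x : (x \in cells k) = clique_in [set: G] x && (#|x| == k).
Proof.
case: k => [|k]; first by rewrite inE cards_eq0; case: eqP => [->|]; rewrite ?clique_in0 ?andbF.
rewrite inE simplex_clique -cards_eq0.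
by case: eqP => [->|]; rewrite ?andbF.
Qed.

Definition incidenceZ y x : int := \sum_(v in x | y == x :\ v) vsign le x v.

Definition bdmx k : 'M[int]_(#|cells k|, #|cells k.+1|) :=
  \matrix_(i, j) incidenceZ (enum_val i) (enum_val j).

Lemma boundary_incidence f y : bd f y = \sum_x incidenceZ y x * f x.
Proof.
rewrite boundaryE /incidenceZ; under [RHS]eq_bigr => x _ do rewrite mulr_suml.
rewrite [RHS](exchange_big_dep (fun v => v \notin y)) /=; last first.
  by move=> x v _ /andP[_ /eqP->]; rewrite !inE eqxx.
apply: eq_bigr => v vy; rewrite (big_pred1 (v |: y)) => [|x]; first by rewrite vsign_setU1_id.
apply/andP/eqP => [[vx /eqP->]|->]; first by rewrite setD1K.
by rewrite setU1K // setU11 eqxx.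
Qed.

Lemma incidenceZ_neq0 y x : incidenceZ y x != 0 -> #|x| = #|y|.+1.
Proof.
apply: contraNeq => xy; apply/eqP/big1 => v /andP[vx /eqP yE].
by case/eqP: xy; rewrite yE (cardsD1 v x) vx.
Qed.

Definition coords k f : 'cV[int]_#|cells k| := \col_i f (enum_val i).

Definition chain_of k (v : 'cV[int]_#|cells k|) : chain G :=
  [ffun x : {set G} => \sum_(i | enum_val i == x) v i 0].

Lemma coords_chain_of k (v : 'cV_#|cells k|) : coords k (chain_of v) = v.
Proof.
apply/colP => i; rewrite mxE ffunE (big_pred1 i) // => j.
by rewrite (inj_eq enum_val_inj).
Qed.

Lemma chain_of_notin k (v : 'cV_#|cells k|) x : x \notin cells k -> chain_of v x = 0.
Proof.
move=> xk; rewrite ffunE big1 // => i /eqP xE.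
by rewrite -xE enum_valP in xk.
Qed.

Lemma chain_of_supported k (v : 'cV_#|cells k|) : supported [set: G] (chain_of v).
Proof. by move=> x xA; rewrite chain_of_notin // mem_cells (negPf xA). Qed.

Lemma coords_boundary k f : supported [set: G] f ->
  coords k (bd f) = bdmx k *m coords k.+1 f.
Proof.
move=> Af; apply/colP => i; rewrite !mxE boundary_incidence.
rewrite (bigID (mem (cells k.+1))) /= [X in _ + X]big1 ?addr0.
  by rewrite big_enum_val; apply: eq_bigr => j _; rewrite !mxE.
move=> x; rewrite mem_cells negb_and => /orP[/Af->|xk]; first by rewrite mulr0.
have [->|/incidenceZ_neq0 xE] := eqVneq (incidenceZ (enum_val i) x) 0; first by rewrite mul0r.
have := enum_valP i; rewrite mem_cells => /andP[_ /eqP ik].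
by rewrite xE ik eqxx in xk.
Qed.

Lemma mulmx_col_eq0 (R : pzSemiRingType) m n (M : 'M[R]_(m, n)) :
  (forall w : 'cV_n, M *m w = 0) -> M = 0.
Proof.
move=> M0; apply/matrixP => i j; have /colP/(_ i) := M0 (delta_mx j 0).
rewrite -[M *m _]colE !mxE //.
Qed.

Lemma bdmx_bdmx k : bdmx k *m bdmx k.+1 = 0.
Proof.
apply: mulmx_col_eq0 => w; rewrite -mulmxA -[w]coords_chain_of.
have Aw := chain_of_supported w; have Abw := supported_boundary le Aw.
rewrite -!coords_boundary // boundary_boundary //.
by apply/colP => i; rewrite !mxE ffunE.
Qed.

Lemma boundary_chain_of k (v : 'cV_#|cells k.+1|) :
  bdmx k *m v = 0 -> bd (chain_of v) = 0.
Proof.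
move=> v0; have Av := chain_of_supported v; apply/ffunP => y; rewrite ffunE.
have [yk|] := boolP (y \in cells k).
  rewrite -(enum_rankK_in yk yk); set i := enum_rank_in _ _.
  have /colP/(_ i) := coords_boundary k Av.
  by rewrite coords_chain_of v0 !mxE.
rewrite mem_cells negb_and => /orP[yA|yk].
  exact: (supported_boundary le Av).
rewrite boundaryE big1 // => u uy; rewrite chain_of_notin ?mulr0 //.
by rewrite mem_cells cardsU1 uy eqSS (negPf yk) andbF.
Qed.

Lemma boundary_chain_of0 (v : 'cV_#|cells 0|) : bd (chain_of v) = 0.
Proof.
apply/ffunP => y; rewrite ffunE boundaryE big1 // => u uy.
by rewrite chain_of_notin ?mulr0 // mem_cells cardsU1 uy andbF.
Qed.

Lemma acyclic_bdmx k (v : 'cV_#|cells k.+1|) : acyclic_in le [set: G] ->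
  bdmx k *m v = 0 -> exists w, v = bdmx k.+1 *m w.
Proof.
move=> aG /boundary_chain_of v0; have [g Ag gE] := aG _ (chain_of_supported v) v0.
by exists (coords k.+2 g); rewrite -coords_boundary // gE coords_chain_of.
Qed.

Lemma acyclic_bdmx0 (v : 'cV_#|cells 0|) : acyclic_in le [set: G] ->
  exists w, v = bdmx 0 *m w.
Proof.
move=> aG; have [g Ag gE] := aG _ (chain_of_supported v) (boundary_chain_of0 v).
by exists (coords 1 g); rewrite -coords_boundary // gE coords_chain_of.
Qed.

Section Fundamental.
Variables (n : nat) (phi : chain G).
Hypothesis phiF : fundamental_cycle le n [set: G] phi.

Lemma coords_fundamental k : k != n -> coords k phi = 0.
Proof.
move=> kn; have [_ _ phin _ _] := phiF; apply/colP => i; rewrite !mxE phin //.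
by have := enum_valP i; rewrite mem_cells => /andP[_ /eqP->].
Qed.

Lemma coordsD k f g : coords k (f + g) = coords k f + coords k g.
Proof. by apply/colP => i; rewrite !mxE ffunE. Qed.

Lemma coordsMz k f a : coords k (f *~ a) = coords k f *m a%:M.
Proof. by apply/colP => i; rewrite mxE chainMzE mul_mx_scalar !mxE mulrC. Qed.

Lemma fundamental_bdmx k (v : 'cV_#|cells k|) : bd (chain_of v) = 0 ->
  exists a w, v = coords k phi *m a%:M + bdmx k *m w.
Proof.
move=> v0; have [_ _ _ _ gen] := phiF.
have [a [g [Ag fE]]] := gen _ (chain_of_supported v) v0.
exists a, (coords k.+1 g); rewrite -coords_boundary // -coordsMz -coordsD -fE.
by rewrite coords_chain_of.
Qed.

Lemma sphere_bdmx k (v : 'cV_#|cells k.+1|) : k.+1 != n ->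
  bdmx k *m v = 0 -> exists w, v = bdmx k.+1 *m w.
Proof.
move=> kn /boundary_chain_of/fundamental_bdmx[a [w ->]]; exists w.
by rewrite coords_fundamental // mul0mx add0r.
Qed.

Lemma sphere_bdmx0 (v : 'cV_#|cells 0|) : 0%N != n -> exists w, v = bdmx 0 *m w.
Proof.
move=> n0; have [a [w ->]] := fundamental_bdmx (boundary_chain_of0 v); exists w.
by rewrite coords_fundamental // mul0mx add0r.
Qed.

End Fundamental.

Lemma sphere_bdmx_top m phi (v : 'cV_#|cells m.+1|) :
  fundamental_cycle le m.+1 [set: G] phi -> pure_in m.+1 [set: G] ->
  bdmx m *m v = 0 -> exists w, v = coords m.+1 phi *m w.
Proof.
move=> phiF [_ dimG] /boundary_chain_of/(fundamental_bdmx phiF)[a [w ->]].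
exists a%:M; rewrite [bdmx _](_ : _ = 0) ?mul0mx ?addr0 //.
apply/matrixP => i j; have := enum_valP j; rewrite mem_cells => /andP[/dimG].
by move=> + /eqP ej; rewrite ej ltnn.
Qed.

(** A single coefficient +-1 inverts the column from the left, and its squared norm counts the
    facets. *)
Lemma fundamental_unimod_fact n phi : fundamental_cycle le n [set: G] phi ->
  pure_in n [set: G] ->
  exists F : unimod_fact (coords n phi), gram_l F = #|cells n|%:Z.
Proof.
move=> [_ _ _ phi1 _] [pureG _]; have [y [yG _ yn]] := pureG _ (clique_in0 _).
have yc : y \in cells n by rewrite mem_cells yG yn /=.
have sq (i : 'I_#|cells n|) : phi (enum_val i) * phi (enum_val i) = 1.
  have := enum_valP i; rewrite mem_cells => /andP[iG /eqP iN].
  by have := phi1 _ iG iN; case: (phi _) => [[|[|]]|[|]].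
pose i0 := enum_rank_in yc y.
have lK : (phi (enum_val i0) *: delta_mx 0 i0) *m coords n phi = 1%:M.
  rewrite -scalemxAl -rowE; apply/matrixP => a b.
  by rewrite !mxE (ord1 a) (ord1 b) eqxx sq.
have e1 : coords n phi = coords n phi *m 1%:M by rewrite mulmx1.
exists (UnimodFact e1 lK (mulmx1 1%:M)); rewrite /gram_l /=.
rewrite [_ *m _](_ : _ = (#|cells n|%:Z)%:M) ?det_scalar1 //.
apply/matrixP => a b; rewrite !mxE (ord1 a) (ord1 b) eqxx mulr1n.
under eq_bigr => i _ do rewrite !mxE sq.
by rewrite sumr_const card_ord natz.
Qed.

Variable C : numClosedFieldType.

Definition bdmxC k : 'M[C]_(#|cells k|, #|cells k.+1|) := map_mx intr (bdmx k).

Lemma exterior_derivative_bdmx k : exterior_derivative C le k = (bdmxC k.+1)^T.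
Proof.
apply/matrixP => i j; rewrite !mxE rmorph_sum; apply: eq_bigr => v _.
by rewrite rmorphXn rmorphN1.
Qed.

Lemma Det_laplacian0 : Det (laplacian C le 0) = Det (bdmxC 1 *m (bdmxC 1)^T).
Proof. by rewrite /laplacian addr0 exterior_derivative_bdmx trmxK. Qed.

Lemma Det_laplacianS k : Det (laplacian C le k.+1) =
  Det (bdmxC k.+2 *m (bdmxC k.+2)^T) * Det (bdmxC k.+1 *m (bdmxC k.+1)^T).
Proof.
have M12 : bdmxC k.+1 *m bdmxC k.+2 = 0 by rewrite -map_mxM bdmx_bdmx map_mx0.
have M21 : (bdmxC k.+2)^T *m (bdmxC k.+1)^T = 0 by rewrite -trmx_mul M12 trmx0.
rewrite -[Det (bdmxC k.+1 *m _)]Det_gram -Det_addM; last first.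
  by rewrite -mulmxA [_^T *m (_ *m _)]mulmxA M21 mul0mx mulmx0.
by rewrite /laplacian !exterior_derivative_bdmx !trmxK.
Qed.

Lemma torsion_bdmx m : clique_number G = m.+1 ->
  torsion C le = \prod_(k < m) Det (bdmxC k.+1 *m (bdmxC k.+1)^T) ^ ((-1) ^+ k).
Proof.
move=> cG; rewrite /torsion cG.
apply: (torsion_telescope (a := fun k => Det (bdmxC k.+1 *m (bdmxC k.+1)^T))
  (b := fun k => Det (laplacian C le k))).
- by move=> k; apply: Det_neq0.
- exact: Det_laplacian0.
- exact: Det_laplacianS.
rewrite [bdmxC _](_ : _ = 0) ?mul0mx ?Det0 //; apply/matrixP => i j.
have := enum_valP j; rewrite inE => /andP[sj /eqP cj].
have := leq_bigmax_cond (F := fun x : {set G} => #|x|) _ sj.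
by rewrite -/(clique_number G) cG cj ltnn.
Qed.

Lemma card_cells1 : #|cells 1| = #|G|.
Proof.
rewrite -cardsT -(card_imset _ (@set1_inj G)); apply: eq_card => x; rewrite mem_cells.
apply/andP/imsetP => [[_ /cards1P[u ->]]|[u _ ->]]; first by exists u.
by rewrite clique_in_set1 inE cards1.
Qed.

Lemma Det_augmentation : (0 < #|G|)%N -> Det (bdmxC 0 *m (bdmxC 0)^T) = #|G|%:R.
Proof.
move=> G0; have e0 (i : 'I_#|cells 0|) : enum_val i = set0.
  by have := enum_valP i; rewrite inE => /eqP.
have -> : bdmxC 0 *m (bdmxC 0)^T = (#|G|%:R)%:M.
  apply/matrixP => i j; rewrite !mxE.
  have -> : (i == j) = true by apply/eqP/enum_val_inj; rewrite !e0.
  rewrite mulr1n -card_cells1 (eq_bigr (fun _ => 1)) => [|k _].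
    by rewrite sumr_const card_ord.
  rewrite !mxE !e0 -rmorphM; have := enum_valP k; rewrite mem_cells => /andP[_ /cards1P[u ->]].
  rewrite /incidenceZ (big_pred1 u) ?vsign_sq // => v; rewrite inE.
  by rewrite /=; case: (eqVneq v u) => [->|//]; rewrite setDv eqxx.
by rewrite Det_unit det_scalar cards1 ?expr1 // pnatr_eq0 -lt0n.
Qed.

Lemma acyclic_torsion : (0 < #|G|)%N -> acyclic_in le [set: G] -> torsion C le = #|G|%:R.
Proof.
move=> G0 aG; have [m cG] : exists m, clique_number G = m.+1.
  have /card_gt0P[u _] := G0; exists (clique_number G).-1; rewrite prednK //.
  have su : simplex [set u].
    by rewrite simplex_clique clique_in_set1 inE andbT; apply/set0Pn; exists u; rewrite inE.
  by have := leq_bigmax_cond (F := fun x : {set G} => #|x|) _ su; rewrite cards1.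
have exact k (v : 'cV_#|cells k.+1|) : bdmx k *m v = 0 -> exists w, v = bdmx k.+1 *m w.
  exact: acyclic_bdmx.
have H := saturated_unimod_fact (exact_saturated (bdmx_bdmx m) (exact m)).
rewrite (torsion_bdmx cG).
rewrite (exact_complex_Det C H bdmx_bdmx); first last.
- exact: exact.
- exact: bdmx_bdmx.
- by move=> k v _; apply: exact.
- by move=> v; apply: acyclic_bdmx0.
rewrite Det_augmentation //.
(* No cells lie above the top, so the closing map has rank 0 and its Gram determinant is empty. *)
have c0 : #|cells m.+2| = 0%N.
  apply: eq_card0 => x; rewrite inE; apply/negP => /andP[sx /eqP cx].
  have := leq_bigmax_cond (F := fun x : {set G} => #|x|) _ sx.
  by rewrite -/(clique_number G) cG cx ltnn.
have r0 : uf_rank H = 0%N.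
  by apply/eqP; rewrite -leqn0; apply: leq_trans (mulmx1_min (uf_rK H)) _; rewrite c0.
rewrite /gram_l; move: (uf_l H); rewrite r0 => A.
by rewrite det_mx00 exp1rz mulr1.
Qed.

Lemma sphere_torsion n : sphere_in le n.+1 [set: G] -> (0 < #|G|)%N ->
  clique_number G = n.+1 /\
  torsion C le = #|G|%:R * #|cells n.+1|%:R ^ ((-1) ^+ n.+1).
Proof.
move=> [pureG _ [phi phiF]] G0.
have cG : clique_number G = n.+1.
  have [pG dG] := pureG; apply/eqP; rewrite eqn_leq; apply/andP; split.
    by apply/bigmax_leqP => x; rewrite simplex_clique => /andP[_ /dG].
  have [y [yG _ yn]] := pG _ (clique_in0 _).
  have sy : simplex y by rewrite simplex_clique yG -cards_eq0 yn.
  by have := leq_bigmax_cond (F := fun x : {set G} => #|x|) _ sy; rewrite yn.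
split=> //; have [H HE] := fundamental_unimod_fact phiF pureG.
rewrite (torsion_bdmx cG) (exact_complex_Det C H bdmx_bdmx).
- by rewrite Det_augmentation // HE.
- by move=> v; apply: sphere_bdmx0 phiF _ _.
- by move=> k v kn; apply: (sphere_bdmx phiF); rewrite eqSS ltn_eqF.
- have [Aphi phi0 _ _ _] := phiF; rewrite -coords_boundary // phi0.
  by apply/colP => i; rewrite !mxE ffunE.
by move=> v; apply: sphere_bdmx_top.
Qed.

End BoundaryMatrices.

Arguments cells : simpl never.

(** * Graph Laplacians of a graph and of the dual of a sphere *)

Section GraphLaplacians.
Variables (G : sgraph) (le : rel G).
Hypotheses (le_total : total le) (le_anti : antisymmetric le).
Variable C : numClosedFieldType.

Implicit Types (x y : {set G}).

Local Notation incidenceZ := (incidenceZ le).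
Local Notation bdmx := (bdmx le).
Local Notation bdmxC := (bdmxC le C).

Lemma incidenceZ_setU1 v y : v \notin y -> incidenceZ y (v |: y) = vsign le y v.
Proof.
move=> vy; rewrite /incidenceZ (big_pred1 v) ?vsign_setU1_id // => w.
apply/andP/eqP => [[]|->]; last by rewrite setU11 setU1K ?eqxx.
rewrite !inE => /predU1P[//|wy] /eqP/setP/(_ w).
by rewrite !inE eqxx wy.
Qed.

Lemma incidenceZ_cover y x : incidenceZ y x != 0 ->
  exists v, v \notin y /\ x = v |: y.
Proof.
move=> i0; have [v /andP[vx /eqP yE]] : exists v, (v \in x) && (y == x :\ v).
  apply/existsP; apply: contraNT i0 => /existsPn no.
  by apply/eqP/big1 => v Pv; have := no v; rewrite Pv.
by exists v; rewrite yE setD11 setD1K.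
Qed.

Lemma connected_torsion_trees : connected G ->
  Det (bdmxC 1 *m (bdmxC 1)^T) = #|rooted_spanning_trees G|%:R.
Proof.
have vert (i : 'I_#|cells G 1|) : exists u, enum_val i = [set u].
  by have := enum_valP i; rewrite mem_cells => /andP[_ /cards1P].
have [rho rhoE] := fin_all_exists vert.
have rhoB : bijective rho.
  apply: inj_card_bij; last by rewrite card_ord card_cells1.
  by move=> i j ij; apply: enum_val_inj; rewrite !rhoE ij.
apply: (Det_laplacian_connected rhoB) => [i j ij|i]; last first.
  under eq_bigr => j _ do rewrite mxE.
  rewrite exchange_big /= big1 // => e _; rewrite !mxE.
  under eq_bigr => j _ do rewrite !mxE.
  rewrite -mulr_sumr -rmorph_sum /=.
  have [z zE] : exists z : 'I_#|cells G 0|, enum_val z = set0.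
    have c0 : set0 \in cells G 0 by rewrite inE.
    by exists (enum_rank_in c0 set0); rewrite enum_rankK_in.
  (* The augmentation row consists of ones, so this says that each column of [bdmx 1] sums to 0. *)
  have /matrixP/(_ z e) := bdmx_bdmx le_total le_anti 0; rewrite !mxE => e0.
  rewrite [X in _ * X%:~R](_ : _ = 0) ?mulr0 //; apply: etrans e0; apply: eq_bigr => j _.
  have inc0 : incidenceZ set0 [set rho j] = 1.
    by rewrite -[[set _]]setU0 incidenceZ_setU1 ?inE // vsign0.
  by rewrite !mxE zE {2}rhoE inc0 mul1r.
have nuv : rho i != rho j by rewrite (inj_eq (bij_inj rhoB)).
rewrite !mxE. under eq_bigr => e _ do rewrite !mxE !rhoE -rmorphM.
rewrite -rmorph_sum /=; set u := rho i in nuv *; set v := rho j in nuv *.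
have unique e : e != [set u; v] -> incidenceZ [set u] e * incidenceZ [set v] e = 0.
  apply: contraNeq; rewrite mulf_eq0 negb_or => /andP[].
  move=> /incidenceZ_cover[a [_ ea]] /incidenceZ_cover[b [_ eb]].
  have : v \in e by rewrite eb !inE eqxx orbT.
  by rewrite ea !inE [v == u]eq_sym (negPf nuv) orbF => /eqP->; rewrite setUC.
have [uv|nuvadj] := boolP (adj u v); last first.
  rewrite big1 ?oppr0 // => e _; apply: unique; apply: contraNneq nuvadj => eE.
  have := enum_valP e; rewrite mem_cells eE => /andP[/clique_inP[_]].
  by move/(_ u v)=> + _; apply; rewrite ?inE ?eqxx ?orbT.
have e0E : [set u; v] \in cells G 2 by apply: edge_simplex.
rewrite (bigD1 (enum_rank_in e0E [set u; v])) //= enum_rankK_in // big1 ?addr0 => [|e eE].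
  rewrite {1}setUC !incidenceZ_setU1 ?inE // 1?eq_sym //.
  rewrite -[[set u]]setU0 -[[set v]]setU0 !vsign_setU1 ?inE // 1?eq_sym //.
  rewrite !vsign0 !mul1r (le_alt le_total le_anti nuv).
  by case: (le u v); rewrite ?mulr1 ?mul1r ?rmorphN ?rmorph1.
by apply: unique; rewrite -(enum_rankK_in e0E e0E) (inj_eq enum_val_inj).
Qed.

(** * The dual graph of a sphere *)

Section Dual.
Variable n : nat.
Hypothesis sphereG : sphere_in le n.+1 [set: G].

Let pureG : pure_in n.+1 [set: G] := let: And3 p _ _ := sphereG in p.

Lemma pure_facets : facets G = cells G n.+1.
Proof.
have [pG dG] := pureG; apply/setP => x; rewrite inE mem_cells.
apply/maxsetP/andP => [[sx xmax]|[xG /eqP xn]].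
  have := sx; rewrite simplex_clique => /andP[_ xG]; split=> //.
  have [y [yG xy yn]] := pG x xG; rewrite -(xmax y) ?yn //.
  by rewrite simplex_clique yG -cards_eq0 yn.
split; first by rewrite simplex_clique xG -cards_eq0 xn.
move=> y; rewrite simplex_clique => /andP[_ /dG yn] xy; apply/eqP.
by rewrite eq_sym eqEcard xy xn.
Qed.

Lemma card_dual : #|dual G| = #|cells G n.+1|.
Proof. by rewrite card_sig -pure_facets; apply: eq_card => x; rewrite !inE. Qed.

Lemma thin_cofaces y : clique_in [set: G] y -> #|y| = n ->
  exists a b, [/\ a != b, a \notin y, b \notin y &
    forall v, v \notin y -> clique_in [set: G] (v |: y) = (v \in [set a; b])].
Proof.
move=> yG yn; have [_ /(_ y yG) thin _] := sphereG.
have /eqP/cards2P[a [b [ab abE]]] := thin (congr1 S yn).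
have mem v : v \in [set a; b] -> v \notin y by rewrite -abE inE => /andP[].
exists a, b; split=> //; [by apply: mem; rewrite !inE eqxx| |].
  by apply: mem; rewrite !inE eqxx orbT.
by move=> v vy; rewrite -abE inE vy.
Qed.

Lemma boundary_thin f y a b : supported [set: G] f ->
  a != b -> a \notin y -> b \notin y ->
  (forall v, v \notin y -> clique_in [set: G] (v |: y) = (v \in [set a; b])) ->
  boundary le f y = vsign le y a * f (a |: y) + vsign le y b * f (b |: y).
Proof.
move=> Af ab ay bY abE; rewrite boundaryE (bigD1 a) //= (bigD1 b) ?bY 1?eq_sym //=.
rewrite big1 ?addr0 // => v /andP[/andP[vy va] vb]; rewrite Af ?mulr0 //.
by rewrite abE // !inE negb_or va vb.
Qed.

Lemma setI_cofaces y (a b : G) : a != b -> a \notin y -> b \notin y ->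
  (a |: y) :&: (b |: y) = y.
Proof.
move=> ab ay bY; apply/setP => v; rewrite !inE.
case: (eqVneq v a) => [->|]; first by rewrite (negPf ab) (negPf ay).
by case: (eqVneq v b) => [->|] //=; rewrite ?(negPf bY) ?andbb.
Qed.

(** Restricting the fundamental cycle to one component of the dual graph leaves a cycle, because the
    two facets at a ridge are adjacent. It is therefore a non-zero multiple of the full cycle, whose
    coefficients never vanish, so the component is everything. *)
Lemma dual_connected : connected (dual G).
Proof.
have [pG dG] := pureG; have [_ _ [phi phiF]] := sphereG.
have [Aphi phi0 _ phi1 _] := phiF.
have facetE x : (x \in facets G) = clique_in [set: G] x && (#|x| == n.+1).
  by rewrite pure_facets mem_cells.
have [x0 [x0G _ x0n]] := pG _ (clique_in0 _).
have x0F : x0 \in facets G by rewrite facetE x0G x0n /=.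
pose p0 : dual G := exist _ x0 x0F.
pose W x := [exists q : dual G, (val q == x) && connect (@dual_adj G) p0 q].
have sym : connect_sym (@dual_adj G) by apply/sym_connect_sym/dual_sym.
have W_adj y a b : a != b -> a \notin y -> b \notin y -> #|y| = n ->
    a |: y \in facets G -> b |: y \in facets G -> W (a |: y) -> W (b |: y).
  move=> ab ay bY yn _ bF /existsP[q /andP[/eqP qE conq]].
  apply/existsP; exists (exist _ (b |: y) bF); rewrite eqxx /=.
  apply: connect_trans conq (connect1 _).
  by rewrite /dual_adj qE /= setI_cofaces // !cardsU1 ay bY eqxx.
pose psi : chain G := [ffun x : {set G} => if W x then phi x else 0].
have Apsi : supported [set: G] psi by move=> x xG; rewrite ffunE Aphi // if_same.
have psi0 : boundary le psi = 0.
  apply/ffunP => y; rewrite [RHS]ffunE.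
  have [yG|yG] := boolP (clique_in [set: G] y); last first.
    exact: (supported_boundary le Apsi).
  have [yn|yn] := eqVneq #|y| n; last first.
    rewrite boundaryE big1 // => v vy; rewrite ffunE; case: ifP => [|_]; last by rewrite mulr0.
    case/existsP=> q /andP[/eqP qE _]; have := valP q; rewrite facetE qE cardsU1 vy.
    by rewrite eqSS (negPf yn) andbF.
  have [a [b [ab ay bY abE]]] := thin_cofaces yG yn.
  have aF : a |: y \in facets G by rewrite facetE cardsU1 ay yn abE // !inE eqxx /=.
  have bF : b |: y \in facets G by rewrite facetE cardsU1 bY yn abE // !inE eqxx orbT /=.
  have WE : W (a |: y) = W (b |: y).
    by apply/idP/idP; apply: W_adj; rewrite // eq_sym.
  rewrite (boundary_thin Apsi ab ay bY abE) !ffunE -WE.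
  move/ffunP/(_ y): phi0; rewrite (boundary_thin Aphi ab ay bY abE) ffunE.
  by case: (W _) => // _; rewrite !mulr0 addr0.
have [a aE] := fundamental_cycle_top pureG phiF Apsi psi0.
have Wx0 : W x0 by apply/existsP; exists p0; rewrite eqxx connect0.
have a1 : a != 0.
  have := aE x0; rewrite x0n leqnn ffunE Wx0 => /(_ isT) e; apply/eqP => a0.
  by have := phi1 _ x0G x0n; rewrite e a0 mulr0.
suff toroot q : connect (@dual_adj G) p0 q.
  apply/andP; split; first by apply/card_gt0P; exists p0.
  apply/forallP => p; apply/forallP => q.
  by apply: connect_trans (toroot q); rewrite sym.
have := valP q; rewrite facetE => /andP[qG /eqP qn].
have := aE (val q); rewrite qn leqnn ffunE => /(_ isT).
case: ifP => [/existsP[q' /andP[/eqP/val_inj-> //]]|_ /esym/eqP].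
rewrite mulf_eq0 (negPf a1) orbF => /eqP phiq.
by have := phi1 _ qG qn; rewrite phiq.
Qed.

(* The signs of the fundamental cycle conjugate the top Laplacian into the
   Laplacian of the dual graph. *)
Lemma Det_dual_laplacian :
  Det (bdmxC n *m (bdmxC n)^T) = #|rooted_spanning_trees (dual G)|%:R.
Proof.
have [_ _ [phi phiF]] := sphereG; have [Aphi phi0 _ phi1 _] := phiF.
have fF (i : 'I_#|cells G n.+1|) : enum_val i \in facets G.
  by rewrite pure_facets; apply: enum_valP.
pose rho (i : 'I_#|cells G n.+1|) : dual G := exist _ (enum_val i) (fF i).
have rhoB : bijective rho.
  apply: inj_card_bij; last by rewrite card_ord card_dual.
  by move=> i j [/enum_val_inj].
have fG (i : 'I_#|cells G n.+1|) : clique_in [set: G] (enum_val i) /\ #|enum_val i| = n.+1.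
  by have := enum_valP i; rewrite mem_cells => /andP[-> /eqP].
pose s (i : 'I_#|cells G n.+1|) : int := phi (enum_val i).
have ss i : s i * s i = 1.
  have [iG iN] := fG i; have := phi1 _ iG iN.
  by rewrite /s; case: (phi _) => [[|[|]]|[|]].
pose P : 'M[C]_#|cells G n.+1| := diag_mx (\row_i (s i)%:~R).
have PP : P *m P = 1%:M.
  rewrite mulmx_diag -diag_const_mx; congr diag_mx.
  by apply/rowP => i; rewrite !mxE -rmorphM ss rmorph1.
rewrite -Det_gram -(Det_conj _ PP).
have LE i j : (P *m ((bdmxC n)^T *m bdmxC n) *m P) i j = (\sum_(e < #|cells G n|)
    (incidenceZ (enum_val e) (enum_val i) * s i) *
    (incidenceZ (enum_val e) (enum_val j) * s j))%:~R.
  rewrite mul_mx_diag mul_diag_mx !mxE mulr_sumr mulr_suml rmorph_sum.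
  apply: eq_bigr => e _; rewrite !mxE /= !rmorphM /=; ring.
apply: (Det_laplacian_connected rhoB _ _ dual_connected) => [i j ij|i]; last first.
  under eq_bigr => j _ do rewrite LE.
  rewrite -rmorph_sum exchange_big /= big1 // => e _; rewrite -mulr_sumr.
  (* After conjugation, the row sums vanish because [phi] is a cycle. *)
  have := coords_boundary le n Aphi; rewrite phi0 => /colP/(_ e).
  rewrite !mxE ffunE => e0; rewrite [X in _ * X](_ : _ = 0) ?mulr0 //.
  apply: etrans (esym e0).
  by apply: eq_bigr => j _; rewrite !mxE.
have adjE : adj (rho i) (rho j) =
    (#|enum_val i| == #|enum_val i :&: enum_val j|.+1) &&
    (#|enum_val j| == #|enum_val i :&: enum_val j|.+1) by [].
rewrite LE {LE}adjE; set x := enum_val i; set y := enum_val j.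
have [[xG xn] [yG yn]] := (fG i, fG j); rewrite -/x -/y in xG xn yG yn *.
have xy : x != y by rewrite (inj_eq enum_val_inj).
have unique (e : {set G}) : e != x :&: y \/ #|x :&: y| <> n ->
    incidenceZ e x * s i * (incidenceZ e y * s j) = 0.
  move=> ne; apply/eqP/negPn/negP; rewrite !mulf_eq0 !negb_or.
  case/andP=> /andP[/incidenceZ_cover[a [ae xE]] _] /andP[/incidenceZ_cover[b [be yE]] _].
  have ab : a != b by apply: contraNneq xy => ab; rewrite xE yE ab.
  case: ne; rewrite xE yE setI_cofaces ?eqxx //.
  by move: xn; rewrite xE cardsU1 ae => -[].
rewrite xn yn !eqSS andbb eq_sym; case: (eqVneq #|x :&: y| n) => xyn; last first.
  by rewrite oppr0 big1 // => e _; apply: unique; right; apply/eqP.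
have e0E : x :&: y \in cells G n.
  by rewrite mem_cells xyn eqxx andbT (clique_in_sub _ xG) ?subsetIl.
rewrite (bigD1 (enum_rank_in e0E (x :&: y))) //= enum_rankK_in // big1 ?addr0 => [|e eE].
  have e0G : clique_in [set: G] (x :&: y) by move: e0E; rewrite mem_cells => /andP[].
  have [a [b [ab ay bY abE]]] := thin_cofaces e0G xyn.
  have cover (z : {set G}) : x :&: y \subset z -> clique_in [set: G] z -> #|z| = n.+1 ->
      z = a |: (x :&: y) \/ z = b |: (x :&: y).
    move=> ez zG zn; have [c cz ce] : exists2 c, c \in z & c \notin x :&: y.
      by apply/subsetPn; apply: contraTN isT => /subset_leq_card; rewrite zn xyn ltnn.
    have zE : z = c |: (x :&: y).
      apply/esym/eqP; rewrite eqEcard subUset sub1set cz ez cardsU1 ce.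
      by rewrite xyn zn add1n leqnn.
    by move: zG; rewrite zE abE // !inE => /pred2P[]->; [left|right].
  have bd0 := boundary_thin Aphi ab ay bY abE; rewrite phi0 ffunE in bd0.
  suff tu : incidenceZ (x :&: y) x * s i * (incidenceZ (x :&: y) y * s j) = -1.
    by rewrite tu rmorphN1.
  (* At the common ridge the cycle condition has just two terms, each +-1; they are opposite, so
     their product is -1. *)
  have opposite (c d : G) : x = c |: (x :&: y) -> y = d |: (x :&: y) ->
      c \notin x :&: y -> d \notin x :&: y ->
      vsign le (x :&: y) c * phi x + vsign le (x :&: y) d * phi y = 0 ->
      incidenceZ (x :&: y) x * s i * (incidenceZ (x :&: y) y * s j) = -1.
    have inc (v : G) (z : {set G}) : z = v |: (x :&: y) -> v \notin x :&: y ->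
        incidenceZ (x :&: y) z = vsign le (x :&: y) v.
      by move=> -> vxy; apply: incidenceZ_setU1.
    move=> xE yE cxy dxy; rewrite (inc c) // (inc d) // => /eqP.
    rewrite addrC addr_eq0 -/(s i) -/(s j) => /eqP->.
    by rewrite mulrN mulrACA vsign_sq ss mulr1.
  have [xE|xE] := cover x (subsetIl _ _) xG xn;
    have [yE|yE] := cover y (subsetIr _ _) yG yn.
  - by case/eqP: xy; apply: etrans xE (esym yE).
  - by apply: (opposite a b) => //; rewrite -xE -yE in bd0.
  - by apply: (opposite b a) => //; rewrite -xE -yE addrC in bd0.
  - by case/eqP: xy; apply: etrans xE (esym yE).
by apply: unique; left; rewrite -(enum_rankK_in e0E e0E) (inj_eq enum_val_inj).
Qed.

End Dual.
End GraphLaplacians.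

(** * Torsion of triangle-free graphs and of spheres *)

Lemma homotopic_to_one_gt0 (G : sgraph) : homotopic_to_one G -> (0 < #|G|)%N.
Proof.
case=> {}G => [->//|v _ _|A /contractible_connected[/card_gt0P[u _] _] _].
  by apply/card_gt0P; exists v.
by apply/card_gt0P; exists (val u).
Qed.

Lemma sphere_succ_gt0 n (G : sgraph) : sphere_succ n.+1 G -> (0 < #|G|)%N.
Proof. by move=> [_ [v _]]; apply/card_gt0P; exists v. Qed.

(** In dimension at least 1 the unit sphere of v is non-empty and joins v to the connected
    complement. *)
Lemma sphere_connected n (G : sgraph) : sphere n.+1 G -> connected G.
Proof.
move=> [GS [v Gv]]; have [_ GP] := contractible_connected Gv.
have /card_gt0P[s _] := sphere_succ_gt0 (GS v).
have vs : adj v (val s) by have := valP s; rewrite inE.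
have sv : val s \in [set~ v] by rewrite !inE; apply: contraTneq vs => ->; rewrite adj_irr.
have sym : connect_sym (@adj G) by apply/sym_connect_sym/adj_sym.
suff toroot u : connect (@adj G) v u.
  apply/andP; split; first by apply/card_gt0P; exists v.
  by apply/forallP => a; apply/forallP => b; apply: connect_trans (toroot b); rewrite sym.
have [->|uv] := eqVneq u v; first exact: connect0.
have uv' : u \in [set~ v] by rewrite !inE.
apply: (GP (fun z : remove_vertex v => connect (@adj G) v (val z)) _
  (exist _ (val s) sv) (exist _ u uv')) => [a b ab va|]; last exact: connect1.
exact: connect_trans va (connect1 (ab : adj (val a) (val b))).
Qed.

Lemma triangle_free_clique_number (G : sgraph) :
  triangle_free G -> (clique_number G <= 2)%N.
Proof.
move=> tf; apply/bigmax_leqP => x; rewrite simplex_clique => /andP[_ /clique_inP[_ xc]].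
rewrite leqNgt; apply/negP => /card_gt2P[u [v [w [[ux vx wx] [uv vw wu]]]]].
by case/negP: (tf u v w); rewrite !xc // eq_sym.
Qed.

Lemma triangle_free_torsion (C : numClosedFieldType) (G : sgraph) (le : rel G) :
  total le -> antisymmetric le -> connected G -> triangle_free G ->
  torsion C le = #|rooted_spanning_trees G|%:R.
Proof.
move=> le_total le_anti conG tf; rewrite -(connected_torsion_trees le_total le_anti C conG).
have := triangle_free_clique_number tf.
have [u _] : exists u : G, u \in G by apply/card_gt0P; case/andP: conG.
have su : simplex [set u].
  by rewrite simplex_clique clique_in_set1 inE andbT; apply/set0Pn; exists u; rewrite inE.
have := leq_bigmax_cond (F := fun x : {set G} => #|x|) _ su.
rewrite cards1 -/(clique_number G).
case cG : (clique_number G) => [|[|[|]]] // _ _; rewrite (torsion_bdmx le_total le_anti C cG).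
  (* Without edges the torsion is an empty product, and the graph Laplacian is zero with pseudo
     determinant 1. *)
  rewrite big_ord0 [bdmxC _ _ 1](_ : _ = 0) ?mul0mx ?Det0 //.
  apply/matrixP => i j; have := enum_valP j; rewrite inE => /andP[sj /eqP cj].
  by have := leq_bigmax_cond (F := fun x : {set G} => #|x|) _ sj; rewrite -/(clique_number G) cG cj.
by rewrite big_ord1 expr0 expr1z.
Qed.

Section SphereTorsion.
Variables (C : numClosedFieldType) (G : sgraph) (le : rel G).
Hypotheses (le_total : total le) (le_anti : antisymmetric le).

Lemma sphere_succ_in n : sphere_succ n G -> sphere_in le n [set: G].
Proof.
move=> sG; rewrite -[[set: G]]imset_id.
exact: (sphere_succ_sphere_in le_total le_anti sG (embedding_id G)).
Qed.

Lemma sphere_torsion_dual k : sphere k G ->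
  torsion C le = #|G|%:R * #|dual G|%:R ^ ((-1) ^+ k.+1).
Proof.
move=> sG; have sI := sphere_succ_in sG.
have [_ ->] := sphere_torsion le_total le_anti C sI (sphere_succ_gt0 sG).
by rewrite (card_dual sI).
Qed.

(** Two factors remain: the Laplacian of the graph, and inverted, the top Laplacian, which is that
    of the dual graph up to signs. *)
Lemma sphere2_torsion : sphere 2 G ->
  torsion C le =
    #|rooted_spanning_trees G|%:R / #|rooted_spanning_trees (dual G)|%:R.
Proof.
move=> sG; have sI := sphere_succ_in sG.
have [cG _] := sphere_torsion le_total le_anti C sI (sphere_succ_gt0 (n := 2) sG).
rewrite (torsion_bdmx le_total le_anti C cG) !big_ord_recr big_ord0 /= mul1r.
rewrite expr0 expr1 expr1z exprN1.
rewrite (connected_torsion_trees le_total le_anti C (sphere_connected (n := 1) sG)).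
by rewrite (Det_dual_laplacian C sI).
Qed.

End SphereTorsion.

Theorem mainTheorem1 (C : numClosedFieldType) (G : sgraph) (le : rel G)
    (le_total : total le) (le_anti : antisymmetric le)
    (le_trans : transitive le) :
  [/\ homotopic_to_one G -> torsion C le = #|G|%:R,
      connected G -> triangle_free G ->
        torsion C le = #|rooted_spanning_trees G|%:R,
      forall r : nat, sphere (2 * r + 1) G ->
        torsion C le = #|G|%:R * #|dual G|%:R,
      forall r : nat, sphere (2 * r) G ->
        torsion C le = #|G|%:R / #|dual G|%:R
    & sphere 2 G ->
        torsion C le =
          #|rooted_spanning_trees G|%:R / #|rooted_spanning_trees (dual G)|%:R].
Proof.
split=> [hG|conG tfG|r sG|r sG|sG].
- apply: acyclic_torsion => //; first exact: homotopic_to_one_gt0.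
  exact: homotopic_to_one_acyclic.
- exact: triangle_free_torsion.
- rewrite (sphere_torsion_dual C le_total le_anti sG).
  by rewrite -signr_odd addn1 /= oddM expr0 expr1z.
- rewrite (sphere_torsion_dual C le_total le_anti sG).
  by rewrite -signr_odd /= oddM expr1 exprN1.
- exact: sphere2_torsion.
Qed.
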